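(* Let $\nu$ be a rotationally invariant probability measure on $\mathbb{C}$ with $\int_{\mathbb{C}} |\log|z||\,d\nu(z)<\infty$, let $n\ge1$, let $(a_k)_{k\in\{0,\dots,n\}}$ be i.i.d. complex random variables with $\mathbb{P}(a_0\ne0)=1$, and let $z_1,\dots,z_n$ be the zeros of the random polynomial $P_n$ associated to $\nu$ and $(a_k)_{k\in\{0,\dots,n\}}$. Then, for every $\lambda>0$, the point process formed by $\lambda z_1,\dots,\lambda z_n$ has the same law as the one formed by the zeros of the random polynomial associated to $\nu(\cdot/\lambda)$ and to the same sequence $(a_k)_{k\in\{0,\dots,n\}}$. In addition, the point process formed by $i(z_1),\dots,i(z_n)$, where $i(z)=1/z$, has the same law as the one formed by the zeros of the random polynomial associated to $i_*\nu$, the pushforward of $\nu$ by $i$, and to the same sequence $(a_k)_{k\in\{0,\dots,n\}}$.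
   Context: For a rotationally invariant probability measure $\mu$ on $\mathbb{C}$ with $\int_{\mathbb{C}}|\log|z||\,d\mu(z)<\infty$, let $V^\mu(z)=\int_{\mathbb{C}}\log|z-w|\,d\mu(w)$ and, on polynomials of degree at most $n$, $\langle P,Q\rangle_{n,\mu}=\int_{\mathbb{C}}P(z)\overline{Q(z)}e^{-2nV^\mu(z)}\,d\mu(z)$. Put $R_{k,n}(z)=z^k/\sqrt{\langle X^k,X^k\rangle_{n,\mu}}$, where $X^k$ denotes the monomial $z\mapsto z^k$. The random polynomial associated to $\mu$ and $(a_k)$ is $P_n(z)=\sum_{k=0}^n a_kR_{k,n}(z)$; almost surely it has degree $n$ and does not vanish at $0$. Zeros are counted with multiplicity, and a point process is a random locally finite configuration of points with multiplicity. The measure $\nu(\cdot/\lambda)$ is $A\mapsto\nu(A/\lambda)$. The pushforward $i_*\nu$ is well-defined since $\nu$ has no atom at $0$. *)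

(* Defs.v *)
From HB Require Import structures.
From mathcomp Require Import all_boot all_order all_algebra.
From mathcomp Require Import all_classical all_reals all_analysis.
From mathcomp Require Import measurable_realfun complex.

Set Implicit Arguments.
Unset Strict Implicit.
Unset Printing Implicit Defensive.

Import Order.TTheory GRing.Theory Num.Theory.
Import numFieldNormedType.Exports.

Local Open Scope classical_set_scope.
Local Open Scope ring_scope.
Local Open Scope complex_scope.

(* The complex plane over R carries its Borel sigma-algebra; its topology is
   the one given by the modulus, which the library attaches to R[i]^o. *)
Definition complex_open (R : realType) : set (set R[i]) := @open R[i]^o.

Section complex_measurable.
Variable R : realType.

HB.instance Definition _ := isPointed.Build R[i] 0.

HB.instance Definition _ := @isMeasurable.Build (sigma_display (@complex_open R))
  R[i] <<s @complex_open R >> (@sigma_algebra0 _ setT _) (@sigma_algebraC _ _)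
  (@sigma_algebra_bigcup _ setT _).

Lemma continuous_measurable_complex (f : R[i]^o -> R[i]^o) :
  continuous f -> measurable_fun [set: R[i]] (f : R[i] -> R[i]).
Proof.
move=> /continuousP cf.
apply: (@measurability _ _ R[i] R[i] setT _ (@complex_open R)) => //.
move=> _ [A oA <-]; rewrite setTI; apply: sub_sigma_algebra; exact: cf.
Qed.

Definition cscale (r : R) (z : R[i]) : R[i] := r%:C * z.

Lemma measurable_cscale (r : R) : measurable_fun [set: R[i]] (cscale r).
Proof.
apply: continuous_measurable_complex => z.
exact: (@scaler_continuous R[i] R[i]^o r%:C).
Qed.

(* i(z) = 1/z, with the convention i(0) = 0 *)
Definition cinv (z : R[i]) : R[i] := 1 / z.

Lemma measurable_cinv : measurable_fun [set: R[i]] cinv.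
Proof.
have o0 : open (~` [set (0 : R[i]^o)]).
  apply: closed_openC; apply: accessible_closed_set1.
  exact/hausdorff_accessible/norm_hausdorff.
apply: (@measurability _ _ R[i] R[i] setT _ (@complex_open R)) => //.
move=> _ [A oA <-]; rewrite setTI.
have -> : cinv @^-1` A = (cinv @^-1` A `&` ~` [set 0]) `|`
    (cinv @^-1` A `&` [set 0]) by rewrite -setIUr setUC setUv setIT.
have m0 : measurable [set (0 : R[i])].
  rewrite -[[set _]]setCK; apply: measurableC; exact: sub_sigma_algebra.
apply: measurableU.
  apply: sub_sigma_algebra; rewrite /complex_open openE => z [/= Az z0].
  have z0' : z != 0 by apply/eqP.
  apply: filterI; last exact: open_nbhs_nbhs.
  have ci : (cinv : R[i]^o -> R[i]^o) x @[x --> (z : R[i]^o)] --> (cinv z : R[i]^o).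
    rewrite /cinv; under eq_fun do rewrite div1r.
    by rewrite div1r; exact: (@inv_continuous R[i]).
  by apply: ci; exact: open_nbhs_nbhs.
have [A0|A0] := pselect (A (cinv 0)).
  by rewrite setIidr// => _ ->.
by rewrite (_ : _ `&` _ = set0)// -subset0 => z [/= Az z0]; apply: A0; rewrite -z0.
Qed.

HB.instance Definition _ (r : R) :=
  isMeasurableFun.Build _ _ _ _ (cscale r) (measurable_cscale r).
HB.instance Definition _ :=
  isMeasurableFun.Build _ _ _ _ cinv measurable_cinv.

End complex_measurable.

Notation complex_probability R :=
  (probability (complex R) R) (only parsing).

Section random_polynomial.
Variable R : realType.
Implicit Types (mu : complex_probability R) (P Q : {poly R[i]}).

Definition rotation_invariant mu :=
  forall u : R[i], `|u| = 1 ->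
  forall A : set R[i], measurable A -> mu [set u * z | z in A] = mu A.

(* log |z|, with the value -oo at 0 *)
Definition log_modulus (z : R[i]) : \bar R := lne (Normc.normc z)%:E.

Definition log_integrable mu :=
  (\int[mu]_z `| log_modulus z | < +oo)%E.

Definition log_potential mu (z : R[i]) : \bar R :=
  \int[mu]_w log_modulus (z - w)%R.

(* e^{-2nV}, V being the potential of mu; it is finite when mu is rotation
   invariant and log-integrable. *)
Definition weight mu (n : nat) (z : R[i]) : R :=
  fine (expeR (- (2 * n)%:R%:E * log_potential mu z)).

Definition cintegral mu (f : R[i] -> R[i]) : R[i] :=
  (Rintegral mu setT (fun z => complex.Re (f z)))
  +i* (Rintegral mu setT (fun z => complex.Im (f z))).

Definition inner mu (n : nat) P Q : R[i] :=
  cintegral mu (fun z => P.[z] * (Q.[z])^* * (weight mu n z)%:C).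

Definition basis_poly mu (n k : nat) : {poly R[i]} :=
  (sqrtC (inner mu n 'X^k 'X^k))^-1 *: 'X^k.

Definition random_poly mu (n : nat) (a : 'I_n.+1 -> R[i]) : {poly R[i]} :=
  \sum_(k < n.+1) a k *: basis_poly mu n k.

(* The measure mu(. / lambda): pushing forward by z |-> lambda z makes it a
   probability measure for every lambda; see dilationE. *)
Definition dilation mu (lambda : R) : complex_probability R :=
  distribution mu (cscale lambda).

Lemma dilationE mu (lambda : R) (A : set R[i]) : lambda != 0 ->
  dilation mu lambda A = mu [set z / lambda%:C | z in A].
Proof.
move=> l0; rewrite /dilation /distribution /= /pushforward /=; congr (mu _).
have l0' : lambda%:C != 0 by rewrite fmorph_eq0.
apply/seteqP; split => [z /= Az|_ /= [z Az <-]].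
  by exists (cscale lambda z) => //; rewrite /cscale mulrC mulKf.
by rewrite /cscale mulrC divfK.
Qed.

Definition inversion mu : complex_probability R := distribution mu (@cinv R).

(* The zeros z_1, ..., z_m, listed with multiplicity. The zero polynomial, for
   which the set of zeros is not a configuration, is given the empty list. *)
Definition zeros P : seq R[i] :=
  if P == 0 then [::] else sval (closed_field_poly_normal P).

End random_polynomial.

Section configuration.
Variable R : realType.

Record configuration := Configuration {
  mult :> R[i] -> nat ;
  _ : forall K : set R[i]^o, compact K ->
        finite_set (K `&` [set z | mult z != 0%N]) }.

Lemma config_of_seq_subproof (s : seq R[i]) (K : set R[i]^o) : compact K ->
  finite_set (K `&` [set z : R[i] | count_mem z s != 0%N]).
Proof.
move=> _; apply: (@sub_finite_set _ _ [set` s]); last exact: finite_seq.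
by move=> z [_ /=]; rewrite -lt0n -has_count has_pred1.
Qed.

Definition config_of_seq (s : seq R[i]) : configuration :=
  Configuration (@config_of_seq_subproof s).

HB.instance Definition _ := gen_eqMixin configuration.
HB.instance Definition _ := gen_choiceMixin configuration.
HB.instance Definition _ := isPointed.Build configuration (config_of_seq [::]).

Definition num_points (B : set R[i]) (xi : configuration) : \bar R :=
  \esum_(z in B) (xi z)%:R%:E.

(* The sigma-algebra on configurations is the smallest one for which all the
   counting maps num_points B, B Borel, are measurable. *)
Definition counting_sets : set (set configuration) :=
  [set E | exists2 B : set R[i], measurable B &
           exists2 Y : set (\bar R), measurable Y & E = num_points B @^-1` Y].

HB.instance Definition _ := @isMeasurable.Build (sigma_display counting_sets)
  configuration <<s counting_sets >> (@sigma_algebra0 _ setT _)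
  (@sigma_algebraC _ _) (@sigma_algebra_bigcup _ setT _).

End configuration.

Section probability_notions.
Context d (Omega : measurableType d) (R : realType) (Pr : probability Omega R).

(* The laws are the image measures of Pr; having one requires measurability,
   since Pr carries no information on non-measurable sets. *)
Definition same_law d' (T : measurableType d') (X Y : Omega -> T) :=
  [/\ measurable_fun setT X, measurable_fun setT Y &
      forall E : set T, measurable E -> Pr (X @^-1` E) = Pr (Y @^-1` E)].

Definition independent d' (T : measurableType d') (I : finType)
    (X : I -> Omega -> T) :=
  forall (J : {set I}) (B : I -> set T), (forall i, measurable (B i)) ->
  Pr (\bigcap_(i in [set` J]) (X i @^-1` B i)) =
  (\prod_(i in J) Pr (X i @^-1` B i))%E.

Definition iid d' (T : measurableType d') (I : finType) (X : I -> Omega -> T) :=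
  [/\ (forall i, measurable_fun setT (X i)), independent X &
      forall i j, same_law (X i) (X j)].

End probability_notions.

(* Main.v *)
Require Import Defs.
From HB Require Import structures.
From mathcomp Require Import all_boot all_order all_algebra.
From mathcomp Require Import all_classical all_reals all_analysis.
From mathcomp Require Import measurable_realfun complex.
From mathcomp Require Import ring lra.

(** The potentials of the transformed measures are explicit. Writing V for the
    potential of nu and L for its value at 0, the potential of the dilated
    measure at lambda z is V(z) + ln lambda, and that of the inverted measure
    at 1/z is V(z) - ln |z| - L. Consequently the squared norm of the monomial
    of degree k gets multiplied by lambda^(2k-2n) under dilation, and becomes
    exp(2nL) times the squared norm of the monomial of degree n-k under
    inversion ([moment_dilation], [moment_inversion]).

    For the dilation, the new random polynomial is thus a nonzero multiple of
    the old one evaluated at z / lambda, so that the two point processes agree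
    at every outcome ([zeros_dilation]). For the inversion, the new random
    polynomial built from the reversed coefficients a_(n-k) is a multiple of
    the reciprocal polynomial of the old one; as soon as a_0 and a_n are
    nonzero, hence almost surely, its zeros are the inverses of the zeros of
    the old one ([zeros_inversion]). Since an i.i.d. family has the same law
    as its reversal ([iid_exchangeable]), the reversal does not affect the law.

    Two facts need work. The first is that the norms of 1 and of X^n are
    finite and nonzero. Rotation invariance gives a uniform bound on the mass
    of small discs: about 1/delta rotates of the disc of radius delta|z|
    around z are disjoint ([near_set_measure_le]). Summing over dyadic radii
    shows that the logarithmic singularity costs at most 8 ln 2 in the
    potential: V(z) is finite, and at least both ln |z| - 8 ln 2 and
    L - 8 ln 2 ([log_potential_ge_ln], [log_potential_ge0]). Hence
    |z|^(2n) e^(-2nV) and e^(-2nV) are bounded.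

    The second is that the zero configuration is a measurable function of the
    coefficients, which the equality of laws includes. A monic polynomial with
    measurable coefficients has a measurable root, namely the
    lexicographically largest one ([measurable_root]); dividing it out and
    repeating gives measurable functions that list all the roots
    ([measurable_roots]), and the number of zeros in a Borel set is a finite
    sum of indicators of these functions. *)

Import Order.TTheory GRing.Theory Num.Theory.
Import numFieldNormedType.Exports.
Local Open Scope classical_set_scope.
Local Open Scope ring_scope.
Local Open Scope complex_scope.

Set Implicit Arguments.
Unset Strict Implicit.
Unset Printing Implicit Defensive.

Local Notation normc := Normc.normc.
Local Notation Re := complex.Re.
Local Notation Im := complex.Im.

(** * The modulus, and measurability of complex functions *)

Section modulus.
Variable R : realType.
Implicit Types z w : R[i].

Lemma normc_ge0 z : 0 <= normc z.
Proof. by case: z => a b; exact: sqrtr_ge0. Qed.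

Lemma normC_normc z : `|z| = (normc z)%:C.
Proof. by case: z => a b; rewrite normc_def. Qed.

Lemma normc_eq0 z : (normc z == 0) = (z == 0).
Proof. by apply/eqP/eqP => [/Normc.eq0_normc//|->]; exact: Normc.normc0. Qed.

Lemma normc_gt0 z : (0 < normc z) = (z != 0).
Proof. by rewrite lt0r normc_ge0 andbT normc_eq0. Qed.

Lemma normc_real (x : R) : normc x%:C = `|x|.
Proof. by rewrite /= expr0n/= addr0 sqrtr_sqr. Qed.

Lemma normc_i : normc 'i%C = 1 :> R.
Proof. by rewrite /= expr0n/= add0r expr1n sqrtr1. Qed.

Lemma normc_ReIm z : normc z <= `|Re z| + `|Im z|.
Proof.
rewrite {1}[z]complexE (le_trans (le_normcD _ _))// Normc.normcM normc_i.
by rewrite mul1r !normc_real.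
Qed.

Lemma Re_le_normc z : `|Re z| <= normc z.
Proof. by rewrite -lecR -normC_normc; exact: normc_ge_Re. Qed.

Lemma Im_le_normc z : `|Im z| <= normc z.
Proof.
case: z => a b /=; rewrite -sqrtr_sqr ler_sqrt ?lerDr ?sqr_ge0//.
by rewrite addr_ge0 ?sqr_ge0.
Qed.

Lemma normcB z w : normc (z - w) = normc (w - z).
Proof. by rewrite -normcN opprB. Qed.

Lemma ball_normc z w (e : R) :
  ball (z : R[i]^o) (e%:C : R[i]) w = (normc (z - w) < e) :> Prop.
Proof. by rewrite -ball_normE /ball_ /= normC_normc ltcR. Qed.

Lemma open_normcP (U : set R[i]^o) : open U <->
  (forall z, U z -> exists2 e : R, 0 < e & forall w, normc (z - w) < e -> U w).
Proof.
split=> [oU z Uz|h].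
  have /nbhs_ballP[e /= e0 eU] : nbhs (z : R[i]^o) U by exact: open_nbhs_nbhs.
  have ee : e = (Re e)%:C by rewrite RRe_real// gtr0_real.
  exists (Re e); first by rewrite -ltcR -ee.
  by move=> w zw; apply: eU; rewrite ee ball_normc.
rewrite openE => z /h[e e0 eU]; apply/nbhs_ballP; exists e%:C => /=.
  by rewrite ltcR.
by move=> w; rewrite ball_normc; exact: eU.
Qed.

End modulus.

Section complex_measurable_fun.
Variable R : realType.

Lemma measurable_Re : measurable_fun [set: R[i]] (@complex.Re R).
Proof.
apply: (measurability _ (RGenOInfty.measurableE R)) => //.
move=> _ [_ [x ->] <-]; rewrite setTI; apply: sub_sigma_algebra.
apply/open_normcP => z /=; rewrite in_itv/= andbT => xz.
exists (Re z - x); first by rewrite subr_gt0.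
move=> w /(le_lt_trans (Re_le_normc _)); rewrite in_itv/= andbT.
rewrite raddfB/= => /(le_lt_trans (ler_norm _)); lra.
Qed.

Lemma measurable_Im : measurable_fun [set: R[i]] (@complex.Im R).
Proof.
apply: (measurability _ (RGenOInfty.measurableE R)) => //.
move=> _ [_ [x ->] <-]; rewrite setTI; apply: sub_sigma_algebra.
apply/open_normcP => z /=; rewrite in_itv/= andbT => xz.
exists (Im z - x); first by rewrite subr_gt0.
move=> w /(le_lt_trans (Im_le_normc _)); rewrite in_itv/= andbT.
rewrite raddfB/= => /(le_lt_trans (ler_norm _)); lra.
Qed.

Variables (d : measure_display) (T : measurableType d).
Implicit Types f g : T -> R[i].

(** The complex plane is second countable, so a complex function is measurable
    as soon as its real and imaginary parts are: an open set is the union of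
    the open rectangles with rational corners that it contains. *)
Lemma measurable_ReImP f : measurable_fun setT (fun x => Re (f x)) ->
  measurable_fun setT (fun x => Im (f x)) -> measurable_fun setT f.
Proof.
move=> mRe mIm; apply: (@measurability _ _ T R[i] setT f (@complex_open R)) => //.
move=> _ [U oU <-]; rewrite setTI.
pose rect (t : (rat * rat) * (rat * rat)) := [set z : R[i] |
  (ratr t.1.1 < Re z < ratr t.1.2) && (ratr t.2.1 < Im z < ratr t.2.2)].
rewrite (_ : f @^-1` U = \bigcup_(t in [set t | rect t `<=` U])
    (f @^-1` rect t)); last first.
  apply/seteqP; split=> [x /= Ufx|x [t /= tU]]; last exact: tU.
  have /open_normcP/(_ _ Ufx)[e e0 eU] := oU.
  have rl (r : R) : exists q : rat, r - e / 2 < ratr q < r.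
    by have [|q] := @rat_in_itvoo R (r - e / 2) r; [lra|rewrite in_itv; exists q].
  have rr (r : R) : exists q : rat, r < ratr q < r + e / 2.
    by have [|q] := @rat_in_itvoo R r (r + e / 2); [lra|rewrite in_itv; exists q].
  have [a /andP[a1 a2]] := rl (Re (f x)); have [b /andP[b1 b2]] := rr (Re (f x)).
  have [c /andP[c1 c2]] := rl (Im (f x)); have [g /andP[g1 g2]] := rr (Im (f x)).
  exists ((a, b), (c, g)); last by rewrite /rect/= a2 b1 c2 g1.
  move=> w; rewrite /rect/= => /andP[/andP[H1 H2] /andP[H3 H4]].
  apply: eU; apply: (le_lt_trans (normc_ReIm _)); rewrite !raddfB/=.
  have : `|Re (f x) - Re w| < e / 2 by rewrite ltr_norml; apply/andP; split; lra.
  have : `|Im (f x) - Im w| < e / 2 by rewrite ltr_norml; apply/andP; split; lra.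
  lra.
rewrite bigcup_mkcond; apply: countable_bigcupT_measurable => // t.
case: ifP => // _.
pose h x := (ratr t.1.1 < Re (f x) < ratr t.1.2) &&
  (ratr t.2.1 < Im (f x) < ratr t.2.2).
have mh : measurable_fun setT h.
  by apply: measurable_and; apply: measurable_and; apply: measurable_fun_ltr.
rewrite (_ : f @^-1` rect t = setT `&` h @^-1` [set true]).
  exact: mh.
by rewrite setTI; apply/seteqP; split.
Qed.

Lemma measurable_ReIm f : measurable_fun setT f ->
  measurable_fun setT (fun x => Re (f x)) *
  measurable_fun setT (fun x => Im (f x)).
Proof.
by move=> mf; split; apply: measurableT_comp mf;
  [exact: measurable_Re|exact: measurable_Im].
Qed.

Lemma measurable_caddD f g : measurable_fun setT f -> measurable_fun setT g ->
  measurable_fun setT (fun x => f x + g x).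
Proof.
move=> /measurable_ReIm[f1 f2] /measurable_ReIm[g1 g2]; apply: measurable_ReImP.
  by under eq_fun do rewrite raddfD/=; exact: measurable_funD.
by under eq_fun do rewrite raddfD/=; exact: measurable_funD.
Qed.

Lemma measurable_cmulM f g : measurable_fun setT f -> measurable_fun setT g ->
  measurable_fun setT (fun x => f x * g x).
Proof.
move=> /measurable_ReIm[f1 f2] /measurable_ReIm[g1 g2]; apply: measurable_ReImP.
  rewrite (_ : (fun x => _) = (fun x => Re (f x) * Re (g x) - Im (f x) * Im (g x))).
    by apply: measurable_funB; exact: measurable_funM.
  by apply/funext => x; case: (f x); case: (g x).
rewrite (_ : (fun x => _) = (fun x => Re (f x) * Im (g x) + Im (f x) * Re (g x))).
  by apply: measurable_funD; exact: measurable_funM.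
by apply/funext => x; case: (f x); case: (g x).
Qed.

Lemma measurable_coppN f : measurable_fun setT f ->
  measurable_fun setT (fun x => - f x).
Proof.
move=> mf; under eq_fun do rewrite -mulN1r.
by apply: measurable_cmulM => //; exact: measurable_cst.
Qed.

Lemma measurable_csubB f g : measurable_fun setT f -> measurable_fun setT g ->
  measurable_fun setT (fun x => f x - g x).
Proof. by move=> mf mg; apply: measurable_caddD => //; exact: measurable_coppN. Qed.

Lemma measurable_csum (I : Type) (s : seq I) (F : I -> T -> R[i]) :
  (forall i, measurable_fun setT (F i)) ->
  measurable_fun setT (fun x => \sum_(i <- s) F i x).
Proof.
move=> mF; elim: s => [|i s IH].
  by under eq_fun do rewrite big_nil; exact: measurable_cst.
under eq_fun do rewrite big_cons.
exact: (@measurable_caddD (F i) (fun x => \sum_(j <- s) F j x)).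
Qed.

Lemma measurable_cexp f k : measurable_fun setT f ->
  measurable_fun setT (fun x => f x ^+ k).
Proof.
move=> mf; elim: k => [|k IH].
  by under eq_fun do rewrite expr0; exact: measurable_cst.
by under eq_fun do rewrite exprS; exact: (@measurable_cmulM f (fun x => f x ^+ k)).
Qed.

Lemma measurable_normc f : measurable_fun setT f ->
  measurable_fun setT (fun x => normc (f x)).
Proof.
move=> /measurable_ReIm[f1 f2].
rewrite (_ : (fun x => _) = (fun x => (Re (f x) ^+ 2 + Im (f x) ^+ 2) `^ 2^-1)).
  apply: (measurableT_comp (measurable_powR _)).
  by apply: measurable_funD; exact: measurable_funX.
by apply/funext => x; case: (f x) => a b; rewrite powR12_sqrt// addr_ge0 ?sqr_ge0.
Qed.

End complex_measurable_fun.

Lemma measurable_complex_set1 (R : realType) (z : R[i]) : measurable [set z].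
Proof.
rewrite (_ : [set z] = setT `&` (fun w => normc (w - z)) @^-1` [set 0%R]).
  suff : measurable_fun setT (fun w : R[i] => normc (w - z)) by apply.
  apply: measurable_normc; apply: measurable_csubB => //.
rewrite setTI; apply/seteqP; split=> [w /= ->|w /= /eqP].
  by rewrite subrr Normc.normc0.
by rewrite normc_eq0 subr_eq0 => /eqP.
Qed.

(** * Mass of small discs under a rotation invariant measure *)

Section near_sets.
Variable R : realType.
Implicit Types z w u : R[i].

(** The scale relative to which the distance of z and w is measured. Being
    symmetric in z and w, it yields lower bounds of ln |z - w| by both ln |z|
    and ln |w|. *)
Definition maxmod z w : R := Num.max (normc z) (normc w).

(** The points w at distance less than delta max(|z|, |w|) from z. *)
Definition near_set (delta : R) z : set R[i] :=
  [set w | normc (z - w) < delta * maxmod z w].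

Lemma measurable_near_set delta z : measurable (near_set delta z).
Proof.
rewrite (_ : near_set delta z = setT `&`
  (fun w => normc (z - w) < delta * maxmod z w) @^-1` [set true]).
  suff : measurable_fun setT (fun w => normc (z - w) < delta * maxmod z w) by exact.
  apply: measurable_fun_ltr.
    apply: measurable_normc; apply: measurable_csubB => //.
  apply: measurable_funM => //; apply: measurable_maxr => //.
  by apply: measurable_normc; exact: measurable_id.
by rewrite setTI; apply/seteqP; split.
Qed.

Lemma near_set_rotate delta z u : normc u = 1 ->
  [set u * w | w in near_set delta z] = near_set delta (u * z).
Proof.
move=> u1; have u0 : u != 0 by rewrite -normc_eq0 u1 oner_eq0.
have E w : near_set delta (u * z) (u * w) = near_set delta z w.
  by rewrite /near_set/= /maxmod -mulrBr !Normc.normcM u1 !mul1r.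
apply/seteqP; split=> [_ [w zw <-]|w]; first by rewrite E.
by rewrite -[w](mulVKf u0) E => zw; exists (u^-1 * w).
Qed.

(** Two rotates of a near set by an angle large compared with delta are
    disjoint. *)
Lemma near_set_disjoint delta z u v w : 0 <= delta <= 2^-1 ->
  4 * delta <= normc (u - v) -> normc u = 1 -> normc v = 1 ->
  near_set delta (u * z) w -> near_set delta (v * z) w -> False.
Proof.
move=> /andP[d0 d2] uv u1 v1; rewrite /near_set/= /maxmod !Normc.normcM u1 v1 !mul1r.
set M := Num.max _ _ => hu hv.
have : normc (u - v) * normc z < 2 * delta * M.
  rewrite -Normc.normcM mulrBl.
  rewrite (_ : u * z - v * z = (u * z - w) - (v * z - w)); last by ring.
  by rewrite (le_lt_trans (le_normcD _ _))// normcN; lra.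
have zM : normc z <= M by rewrite le_max lexx.
have M0 : 0 <= M by rewrite (le_trans _ zM)// normc_ge0.
have M2 : M <= 2 * normc z.
  have wz : normc w <= normc z + delta * M.
    rewrite (_ : w = u * z - (u * z - w)); last by ring.
    rewrite (le_trans (le_normcD _ _))// normcN Normc.normcM u1 mul1r.
    by rewrite lerD2l ltW.
  have : M <= normc z + delta * M.
    by rewrite {1}/M ge_max wz andbT lerDl mulr_ge0.
  nra.
have := normc_ge0 z; nra.
Qed.

(** The point of the upper half of the unit circle with real part t. Points
    with real parts k / N are at mutual distance at least 1 / N. *)
Definition unit_point (t : R) : R[i] := t +i* Num.sqrt (1 - t ^+ 2).

Lemma normc_unit_point t : 0 <= t <= 1 -> normc (unit_point t) = 1.
Proof.
move=> /andP[t0 t1]; rewrite /= sqr_sqrtr; first by rewrite addrC subrK sqrtr1.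
by rewrite subr_ge0 expr_le1.
Qed.

Lemma unit_point_dist s t : `|s - t| <= normc (unit_point s - unit_point t).
Proof. exact: (Re_le_normc (unit_point s - unit_point t)). Qed.

End near_sets.

Section packing.
Variables (R : realType) (nu : complex_probability R).
Hypothesis nu_rot : rotation_invariant nu.

Lemma near_set_measure_rotate delta z (u : R[i]) : normc u = 1 ->
  nu (near_set delta (u * z)) = nu (near_set delta z).
Proof.
move=> u1; rewrite -near_set_rotate//; apply: nu_rot; last exact: measurable_near_set.
by rewrite normC_normc u1.
Qed.

(** N disjoint rotates of the near set, all of the same mass, have total mass
    at most 1. *)
Lemma near_set_measure_le (N : nat) (delta : R) z : 0 <= delta <= 2^-1 ->
  4 * delta * N%:R <= 1 -> (N%:R%:E * nu (near_set delta z) <= 1)%E.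
Proof.
move=> d02 dN.
case: N dN => [|N] dN; first by rewrite mul0e lee_fin ler01.
pose u (k : 'I_N.+1) := unit_point (k%:R / N.+1%:R : R).
have N0 : (0 : R) < N.+1%:R by rewrite ltr0n.
have u1 k : normc (u k) = 1.
  apply: normc_unit_point; rewrite divr_ge0//= ler_pdivrMr// mul1r ler_nat.
  exact: ltnW.
have disj : trivIset setT (fun k => near_set delta (u k * z)).
  move=> k l _ _ [w [hk hl]]; apply/eqP/negP => /negP kl.
  apply: (near_set_disjoint d02 _ (u1 k) (u1 l) hk hl).
  apply: le_trans (unit_point_dist _ _).
  rewrite -mulrBl normrM (ger0_norm (_ : 0 <= N.+1%:R^-1))// ler_pdivlMr//.
  apply: (le_trans dN); rewrite ler_normr.
  have : (k < l)%N || (l < k)%N by rewrite -neq_ltn.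
  move=> /orP[] h; apply/orP; [right|left].
    by rewrite opprB -natrB 1?ltnW// ler1n subn_gt0.
  by rewrite -natrB 1?ltnW// ler1n subn_gt0.
have := measure_bigsetU_ord nu xpredT (fun k => measurable_near_set delta (u k * z)) disj.
rewrite (eq_bigr (fun=> nu (near_set delta z))); last first.
  by move=> k _; exact: near_set_measure_rotate.
rewrite sumr_const card_ord => H.
have -> : (N.+1%:R%:E * nu (near_set delta z))%E =
    nu (\big[setU/set0]_(k < N.+1) near_set delta (u k * z)).
  by rewrite mule_natl; apply/esym; exact: H.
apply: probability_le1; apply: bigsetU_measurable => k _.
exact: measurable_near_set.
Qed.

(** The form of the right-hand side is that of the terms of a geometric series
    with sum 8. *)
Lemma near_set_measure_pow (j : nat) z :
  (nu (near_set (2^-1 ^+ j) z) <= (8 / (2 ^ j.+1)%:R)%:E)%E.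
Proof.
have p1 := probability_le1 nu (measurable_near_set (2^-1 ^+ j) z).
case: (leqP j 1) => [j1|j1].
  (* for j <= 1 the bound exceeds 1 *)
  rewrite (le_trans p1)// lee_fin; case: j j1 {p1} => [|[|//]] _; lra.
have := @near_set_measure_le (2 ^ (j - 2)) (2^-1 ^+ j) z.
case: j j1 {p1} => [//|[//|j]] _; rewrite subn2/=.
set p := nu _ => H.
have : ((2 ^ j)%:R%:E * p <= 1)%E.
  apply: H.
    rewrite exprn_ge0//= exprS ger_pMr// exprn_ile1//.
    by rewrite invf_le1// ler1n.
  have e : 2^-1 ^+ j * 2 ^+ j = 1 :> R by rewrite -exprMn mulVf// expr1n.
  rewrite natrX !exprS; move: e; set a := 2^-1 ^+ j; set b := 2 ^+ j => e.
  by nra.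
have : p \is a fin_num by apply: fin_num_measure; exact: measurable_near_set.
move=> /fineK <-; rewrite -EFinM !lee_fin => h.
have e0 : (0:R) < (2 ^ j)%:R by rewrite ltr0n expn_gt0.
by rewrite !expnS !natrM !mulrA ler_pdivlMr ?mulr_gt0//; nra.
Qed.

End packing.

(** * Bounds on the logarithmic kernel *)

Section log_kernel.
Variable R : realType.
Implicit Types z w : R[i].

Lemma log_modulusE z : z != 0 -> log_modulus z = (ln (normc z))%:E.
Proof. by move=> z0; rewrite /log_modulus lne_EFin// normc_gt0. Qed.

Lemma log_modulus0 : log_modulus (0 : R[i]) = -oo%E.
Proof. by rewrite /log_modulus Normc.normc0 le0_lneNy. Qed.

Lemma log_modulusM z w : z != 0 ->
  log_modulus (z * w) = ((ln (normc z))%:E + log_modulus w)%E.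
Proof.
move=> z0; have [->|w0] := eqVneq w 0; first by rewrite mulr0 log_modulus0.
rewrite !log_modulusE ?mulf_neq0// Normc.normcM lnM ?posrE ?normc_gt0//.
Qed.

Lemma log_modulusN z : log_modulus (- z) = log_modulus z.
Proof. by rewrite /log_modulus normcN. Qed.

Lemma measurable_log_modulus d (T : measurableType d) (f : T -> R[i]) :
  measurable_fun setT f -> measurable_fun setT (fun x => log_modulus (f x)).
Proof.
move=> mf; rewrite /log_modulus /lne.
apply: measurable_fun_ifT => //.
  by apply: measurable_fun_ler => //; exact: measurable_normc.
apply/measurable_EFinP; apply: measurableT_comp; first exact: measurable_ln.
exact: measurable_normc.
Qed.

Lemma maxmod_gt0 z w : z != 0 -> 0 < maxmod z w.
Proof. by move=> z0; rewrite /maxmod lt_max normc_gt0 z0. Qed.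

Lemma normcB_le_maxmod z w : normc (z - w) <= 2 * maxmod z w.
Proof.
rewrite (le_trans (le_normcD _ _))// normcN mulr_natl mulr2n.
rewrite lerD// /maxmod le_max lexx//.
by rewrite orbT.
Qed.

(** An upper bound for - ln t, where t = |z - w| / max(|z|, |w|): it is ln 2
    times the number of j such that t < 2^-j, hence +oo when w = z <> 0. *)
Definition near_log z w : \bar R :=
  (\sum_(j <oo) (ln 2 * \1_(near_set (2^-1 ^+ j) z) w)%:E)%E.

Lemma near_log_term_ge0 z w j :
  (0 <= (ln 2 * \1_(near_set (2^-1 ^+ j) z) w)%:E :> \bar R)%E.
Proof. by rewrite lee_fin mulr_ge0// ln_ge0// ler1n. Qed.

Lemma near_log_ge0 z w : (0 <= near_log z w)%E.
Proof. by apply: nneseries_ge0 => j _ _; exact: near_log_term_ge0. Qed.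

Lemma measurable_near_log z : measurable_fun setT (near_log z).
Proof.
apply: (@ge0_emeasurable_sum _ _ _ setT
  (fun j w => (ln 2 * \1_(near_set (2^-1 ^+ j) z) w)%:E) xpredT).
  by move=> k x _ _; exact: near_log_term_ge0.
move=> k _; apply/measurable_EFinP; apply: measurable_funM => //.
by apply: measurable_indic; exact: measurable_near_set.
Qed.

Lemma near_log_ge z w n :
  (forall j, (j < n)%N -> near_set (2^-1 ^+ j) z w) ->
  ((n%:R * ln 2)%:E <= near_log z w)%E.
Proof.
move=> H; apply: le_trans (@nneseries_lim_ge _ _ xpredT 0 n _); last first.
  by move=> j _ _; exact: near_log_term_ge0.
rewrite big_mkord (eq_bigr (fun=> (ln 2)%:E)); last first.
  by move=> j _; rewrite indicE mem_set ?mulr1//; exact: H.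
by rewrite sumEFin sumr_const card_ord mulr_natl.
Qed.

Lemma log_kernel_ge z w : z != 0 ->
  ((ln (maxmod z w))%:E - near_log z w <= log_modulus (z - w)%R)%E.
Proof.
move=> z0; have M0 := maxmod_gt0 w z0.
have l2 : 0 < ln (2 : R) by rewrite ln_gt0// ltr1n.
have [<-|zw] := eqVneq z w.
  suff -> : near_log z z = +oo%E by rewrite leNye.
  apply/eqyP => A A0; set n := (Num.truncn (A / ln 2)).+1.
  apply: (le_trans _ (@near_log_ge z z n _)).
    by rewrite lee_fin -ler_pdivrMr// ltW// truncnS_gt.
  move=> j _; rewrite /near_set/= subrr Normc.normc0 mulr_gt0//.
  exact: maxmod_gt0.
have zw0 : z - w != 0 by rewrite subr_eq0.
have D0 : 0 < normc (z - w) by rewrite normc_gt0.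
(* the least n with 2^-n <= t satisfies - ln t <= n ln 2 <= near_log z w *)
have ex : exists n, 2^-1 ^+ n * maxmod z w <= normc (z - w).
  exists (Num.truncn (maxmod z w / normc (z - w))).+1.
  set n := (Num.truncn _).+1.
  rewrite exprVn mulrC ler_pdivrMr ?exprn_gt0// mulrC -ler_pdivrMr//.
  apply: (@le_trans _ _ n%:R); first by rewrite ltW// truncnS_gt.
  by rewrite -natrX ler_nat ltnW// ltn_expl.
have [n nP nmin] := ex_minnP ex.
apply: (@le_trans _ _ ((ln (maxmod z w))%:E - (n%:R * ln 2)%:E)%E).
  apply: leeB => //; apply: near_log_ge => j jn; rewrite /near_set/= ltNge.
  by apply/negP => /nmin; rewrite leqNgt jn.
rewrite log_modulusE// -EFinB lee_fin.
rewrite mulr_natl -lnXn// -ln_div ?posrE ?exprn_gt0//.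
rewrite ler_ln ?posrE// ?divr_gt0 ?exprn_gt0//.
by rewrite mulrC -exprVn.
Qed.

Lemma log_kernel_le z w : z != 0 ->
  (log_modulus (z - w)%R <= (ln 2 + ln (maxmod z w))%:E)%E.
Proof.
move=> z0; have M0 := maxmod_gt0 w z0.
have [<-|zw] := eqVneq z w; first by rewrite subrr log_modulus0 leNye.
have zw0 : z - w != 0 by rewrite subr_eq0.
rewrite log_modulusE// lee_fin -lnM ?posrE// ler_ln ?posrE ?mulr_gt0 ?normc_gt0//.
exact: normcB_le_maxmod.
Qed.

Lemma ln_maxmod_gel z w : z != 0 -> ln (normc z) <= ln (maxmod z w).
Proof.
move=> z0; rewrite ler_ln ?posrE ?normc_gt0 ?maxmod_gt0// /maxmod.
by rewrite le_max lexx.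
Qed.

Lemma ln_maxmod_ger z w : z != 0 -> (log_modulus w <= (ln (maxmod z w))%:E)%E.
Proof.
move=> z0; have [->|w0] := eqVneq w 0; first by rewrite log_modulus0 leNye.
rewrite log_modulusE// lee_fin ler_ln ?posrE ?normc_gt0 ?maxmod_gt0// /maxmod.
by rewrite le_max lexx orbT.
Qed.

Lemma ln_maxmod_le z w : z != 0 ->
  ((ln (maxmod z w))%:E <= `|ln (normc z)|%:E + `|log_modulus w|)%E.
Proof.
move=> z0; rewrite /maxmod; case: (leP (normc z) (normc w)) => zw.
  have w0 : w != 0 by rewrite -normc_gt0 (lt_le_trans _ zw)// normc_gt0.
  rewrite log_modulusE// abse_EFin -EFinD lee_fin.
  by rewrite (le_trans (ler_norm _))// lerDr.
rewrite (@le_trans _ _ `|ln (normc z)|%:E)%E//; first by rewrite lee_fin ler_norm.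
by rewrite leeDl.
Qed.

(** The integrable bound that makes the kernel integrable. *)
Lemma log_kernel_abs z w : z != 0 ->
  (`|log_modulus (z - w)%R| <=
    `|(ln 2 + `|ln (normc z)|)%:E + (`|log_modulus w| + near_log z w)|)%E.
Proof.
move=> z0; rewrite [leRHS]gee0_abs; last first.
  by rewrite !adde_ge0 ?near_log_ge0// lee_fin addr_ge0// ln_ge0// ler1n.
have t0 := near_log_ge0 z w.
have l2 : 0 <= ln (2 : R) by rewrite ln_ge0// ler1n.
move: (ln_maxmod_gel w z0) (ln_maxmod_le w z0).
move: (log_kernel_ge w z0) (log_kernel_le w z0).
case: (near_log z w) t0 => [t t0|_|//]; last first.
  move=> _ _ _ _; rewrite addey// ?addey// ?leey//.
  by rewrite -ltNye (lt_le_trans _ (abse_ge0 _)).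
case: (log_modulus w) => [lw| |]; first last.
- by move=> _ _ _ _; rewrite /= leey.
- by move=> _ _ _ _; rewrite /= leey.
case: (log_modulus (z - w)) => [x| |]//=.
rewrite !lee_fin => h1 h2 h3 h4.
have := ler_norm (- ln (normc z)); rewrite normrN => h5.
rewrite ler_norml; apply/andP; split; move: t0; rewrite lee_fin => t0.
  have := normr_ge0 lw; lra.
lra.
Qed.

End log_kernel.

(** * The logarithmic potential *)

Section measurable_potential.
Variables (R : realType) (mu : complex_probability R).

(** The positive and negative parts are handled by Tonelli's theorem. *)
Lemma measurable_log_potential : measurable_fun setT (log_potential mu).
Proof.
pose k (p : R[i] * R[i]) := log_modulus (p.1 - p.2).
have mk : measurable_fun setT k.
  by apply: measurable_log_modulus; apply: measurable_csubB.
rewrite (_ : log_potential mu = (fun z =>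
  fubini_F mu (k^\+)%E z - fubini_F mu (k^\-)%E z)%E); last first.
  apply/funext => z; rewrite /log_potential integralE /fubini_F.
  by congr (_ - _)%E; apply: eq_integral => w _; rewrite ?funeposE ?funenegE.
apply: emeasurable_funB; apply: measurable_fun_fubini_tonelli_F => //.
- exact: measurable_funepos.
- exact: measurable_funeneg.
Qed.

Lemma fine_expeR (x : \bar R) :
  fine (expeR x) = \1_[set y | y \is a fin_num] x * expR (fine x).
Proof.
case: x => [x| |] /=.
- by rewrite indicE mem_set// mul1r.
- by rewrite indicE memNset// mul0r.
- by rewrite indicE memNset// mul0r.
Qed.

Lemma measurable_weight n : measurable_fun setT (weight mu n).
Proof.
rewrite /weight.
have m1 : measurable_fun setT
    (fun z => (- (2 * n)%:R%:E * log_potential mu z)%E).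
  by apply: measurable_funeM; exact: measurable_log_potential.
apply: (measurableT_comp (f := fun x : \bar R => fine (expeR x)) _ m1).
rewrite (funext fine_expeR); apply: measurable_funM.
  apply: measurable_indic; rewrite -[X in measurable X]setTI.
  by apply: emeasurable_fin_num => //; exact: measurable_id.
by apply: measurableT_comp.
Qed.

Lemma weight_ge0 n z : 0 <= weight mu n z.
Proof. by rewrite /weight fine_ge0// expeR_ge0. Qed.

End measurable_potential.

Section potential.
Variables (R : realType) (nu : complex_probability R).
Hypotheses (nu_rot : rotation_invariant nu) (nu_log : log_integrable nu).
Implicit Types z w : R[i].

Lemma log_modulus_integrable : nu.-integrable setT (@log_modulus R).
Proof.
apply/integrableP; split; last exact: nu_log.
by apply: (@measurable_log_modulus _ _ _ id); exact: measurable_id.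
Qed.

Lemma nu_atom0 : nu [set 0] = 0%E.
Proof.
apply: measure_negligible; first exact: measurable_complex_set1.
have := integrable_ae measurableT log_modulus_integrable.
apply: negligibleS => z /= -> /(_ I).
by rewrite log_modulus0.
Qed.

Lemma near_log_integral z : (\int[nu]_w near_log z w <= (8 * ln 2)%:E)%E.
Proof.
have l2 : 0 <= ln (2 : R) by rewrite ln_ge0// ler1n.
rewrite /near_log integral_nneseries//; first last.
- by move=> n w _; exact: near_log_term_ge0.
- move=> k; apply/measurable_EFinP; apply: measurable_funM => //.
  by apply: measurable_indic; exact: measurable_near_set.
apply: le_trans (epsilon_trick0 xpredT _); last by rewrite mulr_ge0.
apply: lee_nneseries => [j _ _|j _].
  by apply: integral_ge0 => w _; exact: near_log_term_ge0.
under eq_integral do rewrite EFinM.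
rewrite ge0_integralZl_EFin//; last first.
  by apply/measurable_EFinP; apply: measurable_indic; exact: measurable_near_set.
rewrite integral_indic//; last exact: measurable_near_set.
rewrite setIT mulrAC [X in (_ <= X%:E)%E]mulrC EFinM; apply: lee_wpmul2l => //.
exact: near_set_measure_pow.
Qed.

Lemma near_log_integrable z : nu.-integrable setT (near_log z).
Proof.
apply/integrableP; split; first exact: measurable_near_log.
under eq_integral do rewrite gee0_abs ?near_log_ge0//.
by apply: (le_lt_trans (near_log_integral z)); rewrite ltry.
Qed.

Lemma cst_integrable (c : R) : nu.-integrable setT (fun=> c%:E).
Proof.
exact: (@finite_measure_integrable_cst _ _ _ nu setT c).
Qed.

Lemma log_kernel_integrable z :
  nu.-integrable setT (fun w => log_modulus (z - w)%R).
Proof.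
have mk : measurable_fun setT (fun w => log_modulus (z - w)).
  by apply: measurable_log_modulus; apply: measurable_csubB => //; exact: measurable_id.
have [z0|z0] := eqVneq z 0.
  apply: le_integrable log_modulus_integrable => // w _.
  by rewrite z0 sub0r log_modulusN.
apply: (le_integrable _ mk (fun w _ => log_kernel_abs w z0)) => //.
apply: integrableD => //; first exact: cst_integrable.
apply: integrableD => //; last exact: near_log_integrable.
exact: integrable_abse log_modulus_integrable.
Qed.

Lemma log_potential_fin_num z : log_potential nu z \is a fin_num.
Proof. exact/integrable_fin_num/log_kernel_integrable. Qed.

Lemma log_potential0 : log_potential nu 0 = (\int[nu]_w log_modulus w)%E.
Proof. by apply: eq_integral => w _; rewrite sub0r log_modulusN. Qed.

Lemma log_potential_ge_ln z : z != 0 ->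
  ln (normc z) - 8 * ln 2 <= fine (log_potential nu z).
Proof.
move=> z0; rewrite -lee_fin fineK ?log_potential_fin_num//.
apply: (@le_trans _ _ (\int[nu]_w ((ln (normc z))%:E - near_log z w))%E).
  rewrite integralB//; [|exact: cst_integrable|exact: near_log_integrable].
  rewrite integral_cst// [X in (_ * X)%E](probability_setT nu) mule1 EFinB leeB//.
  exact: near_log_integral.
apply: le_integral => //.
- by apply: integrableB => //; [exact: cst_integrable|exact: near_log_integrable].
- exact: log_kernel_integrable.
- move=> w _; apply: le_trans (log_kernel_ge w z0).
  by apply: leeB => //; rewrite lee_fin ln_maxmod_gel.
Qed.

Lemma log_potential_ge0 z : z != 0 ->
  fine (log_potential nu 0) - 8 * ln 2 <= fine (log_potential nu z).
Proof.
move=> z0; rewrite -lee_fin EFinB !fineK ?log_potential_fin_num//.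
apply: (@le_trans _ _ (\int[nu]_w (log_modulus w - near_log z w))%E).
  rewrite integralB//; [|exact: log_modulus_integrable|exact: near_log_integrable].
  by rewrite log_potential0 leeB// near_log_integral.
apply: le_integral => //.
- apply: integrableB => //; first exact: log_modulus_integrable.
  exact: near_log_integrable.
- exact: log_kernel_integrable.
- move=> w _; apply: le_trans (log_kernel_ge w z0).
  by apply: leeB => //; exact: ln_maxmod_ger.
Qed.

Lemma weightE n z :
  weight nu n z = expR (- (2 * n)%:R * fine (log_potential nu z)).
Proof. by rewrite /weight -[in LHS](fineK (log_potential_fin_num z)). Qed.

End potential.

(** * Norms of the monomials *)

Section moments.
Variable R : realType.
Implicit Types (mu : complex_probability R) (z w : R[i]).

(** The squared norm of the monomial of degree k, as an extended real. *)
Definition moment mu n k : \bar R :=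
  (\int[mu]_z (normc z ^+ (2 * k) * weight mu n z)%:E)%E.

Lemma moment_integrand_ge0 mu n k z :
  0 <= normc z ^+ (2 * k) * weight mu n z.
Proof. by rewrite mulr_ge0 ?weight_ge0// exprn_ge0// normc_ge0. Qed.

Lemma measurable_moment_integrand mu n k :
  measurable_fun setT (fun z => (normc z ^+ (2 * k) * weight mu n z)%:E).
Proof.
apply/measurable_EFinP; apply: measurable_funM; last exact: measurable_weight.
by apply: measurable_funX; apply: measurable_normc; exact: measurable_id.
Qed.

Lemma moment_ge0 mu n k : (0 <= moment mu n k)%E.
Proof. by apply: integral_ge0 => z _; rewrite lee_fin moment_integrand_ge0. Qed.

(** An infinite moment gives the value 0. *)
Lemma inner_monomial mu n k :
  inner mu n 'X^k 'X^k = (fine (moment mu n k))%:C.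
Proof.
rewrite /inner /cintegral.
have E z : ('X^k).[z] * ('X^k).[z]^* * (weight mu n z)%:C =
    (normc z ^+ (2 * k) * weight mu n z)%:C.
  rewrite hornerXn -sqr_normc normrX -exprM mulnC normC_normc.
  by rewrite rmorphM rmorphXn.
congr (_ +i* _).
  by rewrite /Rintegral /moment; congr fine; apply: eq_integral => z _; rewrite E.
rewrite /Rintegral (eq_integral (cst 0%E)) ?integral0// => z _.
by rewrite E.
Qed.

(** The coefficient of the basis polynomial of degree k. *)
Definition basis_coef mu n k : R[i] := (sqrtC (inner mu n 'X^k 'X^k))^-1.

Lemma basis_coef_scale mu1 mu2 n k1 k2 (c : R) : 0 < c ->
  (moment mu1 n k1 = (c ^+ 2)%:E * moment mu2 n k2)%E ->
  basis_coef mu1 n k1 = (c^-1)%:C * basis_coef mu2 n k2.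
Proof.
move=> c0 E; rewrite /basis_coef !inner_monomial E.
have -> : fine ((c ^+ 2)%:E * moment mu2 n k2) = c ^+ 2 * fine (moment mu2 n k2).
  have := moment_ge0 mu2 n k2; case: (moment mu2 n k2) => [r| |]//= _.
  by rewrite gt0_muley ?lte_fin ?exprn_gt0//= mulr0.
rewrite rmorphM rootCMl; last by rewrite ler0c exprn_ge0// ltW.
rewrite [X in 2.-root X](_ : _ = (c%:C) ^+ 2); last by rewrite rmorphXn.
by rewrite sqrCK ?ler0c ?ltW// invfM fmorphV.
Qed.

Lemma basis_coef_neq0 mu n k :
  (0 < moment mu n k)%E -> (moment mu n k < +oo)%E -> basis_coef mu n k != 0.
Proof.
move=> m0 moo; rewrite /basis_coef inner_monomial invr_eq0 sqrtC_eq0 fmorph_eq0.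
by rewrite gt_eqF// fine_gt0// m0.
Qed.

Lemma random_polyE mu n (a : 'I_n.+1 -> R[i]) :
  random_poly mu a = \poly_(k < n.+1) (a (inord k) * basis_coef mu n k).
Proof.
rewrite /random_poly poly_def; apply: eq_bigr => k _.
by rewrite scalerA inord_val.
Qed.

End moments.

Section moments_of_nu.
Variables (R : realType) (nu : complex_probability R).
Hypotheses (nu_rot : rotation_invariant nu) (nu_log : log_integrable nu).
Implicit Types z w : R[i].

Lemma ae_neq0 (P : R[i] -> Prop) :
  (forall z, z != 0 -> P z) -> {ae nu, forall z, P z}.
Proof.
move=> H; exists [set 0]; split.
- exact: measurable_complex_set1.
- exact: nu_atom0.
- by move=> z /= nP; apply: contrapT => /eqP /H.
Qed.

Lemma moment_gt0 n k : (0 < moment nu n k)%E.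
Proof.
rewrite lt0e moment_ge0 andbT; apply/eqP => m0.
have : (\int[nu]_z `|(normc z ^+ (2 * k) * weight nu n z)%:E| = 0)%E.
  rewrite -m0; apply: eq_integral => z _.
  by rewrite gee0_abs// lee_fin moment_integrand_ge0.
move=> /(ae_eq_integral_abs nu measurableT (measurable_moment_integrand nu n k)).
move=> H; have H0 : {ae nu, forall z, False}.
  have Hn : {ae nu, forall z, z != 0} by exact: ae_neq0.
  apply: filterS2 Hn H => z z0 /(_ I) /= [] /eqP.
  rewrite mulf_eq0 expf_eq0 normc_eq0 (negbTE z0) andbF/= weightE//.
  by rewrite gt_eqF// expR_gt0.
have : nu setT = 0%E.
  by apply: measure_negligible => //; apply: negligibleS H0 => z _ /=; exact.
by rewrite [X in X = _](probability_setT nu) => /eqP; rewrite onee_eq0.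
Qed.

Lemma moment_lty n k C : (forall z, normc z ^+ (2 * k) * weight nu n z <= C) ->
  (moment nu n k < +oo)%E.
Proof.
move=> H; apply: (@le_lt_trans _ _ (\int[nu]_z C%:E)%E).
  apply: ge0_le_integral => //.
  - by move=> z _; rewrite lee_fin moment_integrand_ge0.
  - exact: measurable_moment_integrand.
  - by move=> z _; rewrite lee_fin.
rewrite integral_cst// [X in (_ * X)%E](probability_setT nu) mule1; exact: ltry.
Qed.

(** Only the extreme degrees 0 and n are needed to be of finite norm: they are
    the ones that decide whether the random polynomial has degree n and does
    not vanish at 0. *)
Lemma moment0_lty n : (moment nu n 0 < +oo)%E.
Proof.
pose V0 := fine (log_potential nu 0).
apply: (@moment_lty n 0 (expR (- (2 * n)%:R * (V0 - 8 * ln 2)))) => z.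
rewrite expr0 mul1r weightE// ler_expR ler_wnM2l ?oppr_le0//.
have [->|z0] := eqVneq z 0; last exact: log_potential_ge0.
by rewrite gerBl mulr_ge0// ln_ge0// ler1n.
Qed.

Lemma moment_top_lty n : (0 < n)%N -> (moment nu n n < +oo)%E.
Proof.
move=> n0; apply: (@moment_lty n n (expR ((2 * n)%:R * (8 * ln 2)))) => z.
have [->|z0] := eqVneq z 0.
  by rewrite Normc.normc0 expr0n muln_eq0/= -leqn0 leqNgt n0 mul0r expR_ge0.
rewrite weightE// -[normc z]lnK ?posrE ?normc_gt0// -expRM_natl -expRD ler_expR.
have := log_potential_ge_ln nu_rot nu_log z0; set V := fine _.
have : (0 : R) <= (2 * n)%:R by [].
by set N := (2 * n)%:R => N0 h; nra.
Qed.

End moments_of_nu.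

(** * Potentials and norms under dilation and inversion *)

Section transforms.
Variables (R : realType) (nu : complex_probability R).
Hypotheses (nu_rot : rotation_invariant nu) (nu_log : log_integrable nu).
Implicit Types z w : R[i].

Section dilation.
Variable lambda : R.
Hypothesis l0 : 0 < lambda.

Let lC0 : lambda%:C != 0 :> R[i].
Proof. by rewrite fmorph_eq0 gt_eqF. Qed.

Let normc_l : normc lambda%:C = lambda.
Proof. by rewrite normc_real gtr0_norm. Qed.

Lemma log_potential_dilation z :
  log_potential (dilation nu lambda) (lambda%:C * z) =
  ((ln lambda)%:E + log_potential nu z)%E.
Proof.
have E w : log_modulus (lambda%:C * z - Defs.cscale lambda w) =
    ((ln lambda)%:E + log_modulus (z - w)%R)%E.
  by rewrite /Defs.cscale -mulrBr log_modulusM// normc_l.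
have mk : measurable_fun setT (fun w => log_modulus (lambda%:C * z - w)).
  by apply: measurable_log_modulus; apply: measurable_csubB => //; exact: measurable_id.
rewrite /log_potential /dilation integral_pushforward//=; last first.
  rewrite preimage_setT.
  apply: (@eq_integrable _ _ _ nu setT _
    (fun w => ((ln lambda)%:E + log_modulus (z - w)%R)%E)) => //.
    by move=> w _; rewrite -E.
  by apply: integrableD => //; [exact: cst_integrable|exact: log_kernel_integrable].
rewrite preimage_setT; under eq_integral do rewrite E.
rewrite integralD//; [|exact: cst_integrable|exact: log_kernel_integrable].
by rewrite integral_cst// [X in (_ * X)%E](probability_setT nu) mule1.
Qed.

Lemma weight_dilation n z :
  weight (dilation nu lambda) n (lambda%:C * z) = lambda ^- (2 * n) * weight nu n z.
Proof.
rewrite (weightE nu_rot nu_log) /weight log_potential_dilation.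
rewrite -(fineK (log_potential_fin_num nu_rot nu_log z)) -EFinD -EFinN -EFinM/=.
by rewrite mulrDr expRD !mulNr !expRN !expRM_natl lnK// posrE.
Qed.

Lemma moment_dilation n k : moment (dilation nu lambda) n k =
  (((lambda ^+ n / lambda ^+ k)^-1 ^+ 2)%:E * moment nu n k)%E.
Proof.
rewrite /moment /dilation ge0_integral_pushforward//; first last.
- by move=> z _; rewrite lee_fin moment_integrand_ge0.
- exact: measurable_moment_integrand.
rewrite preimage_setT -ge0_integralZl_EFin.
all: rewrite ?exprn_ge0 ?invr_ge0 ?divr_ge0 ?exprn_ge0 ?(ltW l0)//.
- apply: eq_integral => z _ /=; rewrite /Defs.cscale weight_dilation.
  rewrite Normc.normcM normc_l.
  rewrite -EFinM; congr EFin; rewrite exprMn invf_div expr_div_n -!exprM.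
  rewrite ![(_ * 2)%N]mulnC.
  by ring.
- by move=> z _; rewrite lee_fin moment_integrand_ge0.
- exact: measurable_moment_integrand.
Qed.

Lemma basis_coef_dilation n k : basis_coef (dilation nu lambda) n k =
  (lambda ^+ n / lambda ^+ k)%:C * basis_coef nu n k.
Proof.
rewrite (basis_coef_scale _ (moment_dilation n k)) ?invrK//.
by rewrite invr_gt0 divr_gt0 ?exprn_gt0.
Qed.

End dilation.

(** This follows from |1/z - 1/w| = |z - w| / (|z| |w|), valid for almost all w
    as nu has no atom at 0. *)
Lemma log_potential_inversion z : z != 0 ->
  log_potential (inversion nu) z^-1 =
  (log_potential nu z - (ln (normc z))%:E - log_potential nu 0%R)%E.
Proof.
move=> z0.
pose g w := (log_modulus (z - w)%R - (ln (normc z))%:E - log_modulus w)%E.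
have ig1 : nu.-integrable setT
    (fun w => (log_modulus (z - w)%R - (ln (normc z))%:E)%E).
  by apply: integrableB => //; [exact: log_kernel_integrable|exact: cst_integrable].
have ig : nu.-integrable setT g.
  by apply: integrableB => //; exact: log_modulus_integrable.
have E w : w != 0 -> log_modulus (z^-1 - cinv w) = g w.
  move=> w0; rewrite /g /cinv div1r.
  have [->|zw] := eqVneq z w.
    by rewrite !subrr log_modulus0.
  have zw' : z - w != 0 by rewrite subr_eq0.
  have wz' : w - z != 0 by rewrite subr_eq0 eq_sym.
  rewrite (_ : z^-1 - w^-1 = z^-1 * w^-1 * (w - z)); last by field; rewrite z0 w0.
  rewrite !log_modulusE ?mulf_neq0 ?invr_eq0// -!EFinB; congr EFin.
  rewrite !Normc.normcM !Normc.normcV normcB.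
  rewrite !lnM ?posrE ?mulr_gt0 ?invr_gt0 ?normc_gt0//.
  by rewrite !lnV ?posrE ?normc_gt0//; lra.
have mk : measurable_fun setT (fun w => log_modulus (z^-1 - w)).
  by apply: measurable_log_modulus; apply: measurable_csubB => //; exact: measurable_id.
have mk' : measurable_fun setT ((fun w => log_modulus (z^-1 - w)) \o @cinv R).
  by apply: measurableT_comp mk _; exact: measurable_cinv.
rewrite /log_potential /inversion integral_pushforward//=; last first.
  rewrite preimage_setT; apply: (le_integrable _ mk' _ ig) => // w _ /=.
  have [->|w0] := eqVneq w 0; last by rewrite E.
  rewrite /g /cinv invr0 mulr0 log_modulus0 !subr0 !log_modulusE ?invr_eq0//=.
  exact: leey.
rewrite preimage_setT.
rewrite (ae_eq_integral g)//; last 2 first.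
- exact: measurable_int ig.
- by apply: (ae_neq0 nu_log) => w w0 _; exact: E.
rewrite /g integralB//; last exact: log_modulus_integrable.
rewrite integralB//; [|exact: log_kernel_integrable|exact: cst_integrable].
rewrite integral_cst// [X in (_ * X)%E](probability_setT nu) mule1.
by rewrite -/(log_potential nu 0) log_potential0.
Qed.

Lemma weight_inversion n z : z != 0 -> weight (inversion nu) n z^-1 =
  (expR (n%:R * fine (log_potential nu 0))) ^+ 2 *
  (normc z ^+ (2 * n) * weight nu n z).
Proof.
move=> z0; rewrite (weightE nu_rot nu_log) /weight log_potential_inversion//.
rewrite -(fineK (log_potential_fin_num nu_rot nu_log z)).
rewrite -{1}(fineK (log_potential_fin_num nu_rot nu_log 0)).
rewrite -!EFinB -EFinN -EFinM/= -[normc z in RHS]lnK ?posrE ?normc_gt0//.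
rewrite -!expRM_natl -!expRD; congr expR; rewrite natrM; ring.
Qed.

Lemma moment_inversion n k : (k <= n)%N -> moment (inversion nu) n k =
  (((expR (n%:R * fine (log_potential nu 0))) ^+ 2)%:E * moment nu n (n - k))%E.
Proof.
move=> kn; rewrite /moment /inversion ge0_integral_pushforward//; first last.
- by move=> z _; rewrite lee_fin moment_integrand_ge0.
- exact: measurable_moment_integrand.
rewrite preimage_setT -ge0_integralZl_EFin//; first last.
- exact: measurable_moment_integrand.
- by move=> z _; rewrite lee_fin moment_integrand_ge0.
apply: ae_eq_integral => //.
- apply: measurableT_comp; first exact: measurable_moment_integrand.
  exact: measurable_cinv.
- by apply: measurable_funeM; exact: measurable_moment_integrand.
apply: (ae_neq0 nu_log) => z z0 _ /=.
rewrite /cinv div1r weight_inversion// Normc.normcV; congr EFin.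
have nz : normc z != 0 by rewrite normc_eq0.
rewrite -[in LHS](subnK kn) mulnDr exprD exprVn subnK//.
by field; rewrite expf_neq0.
Qed.

Lemma basis_coef_inversion n k : (k <= n)%N -> basis_coef (inversion nu) n k =
  ((expR (n%:R * fine (log_potential nu 0)))^-1)%:C * basis_coef nu n (n - k).
Proof.
by move=> kn; apply: basis_coef_scale; [exact: expR_gt0|exact: moment_inversion].
Qed.

End transforms.

(** * Measurable roots and the zero configuration *)

Section roots.
Variable R : realType.
Implicit Types (z w : R[i]) (s : seq R[i]) (p : {poly R[i]}).

Lemma rational_point_near z (e : R) : 0 < e ->
  exists q : rat * rat, normc (z - (ratr q.1 +i* ratr q.2)) < e.
Proof.
move=> e0.
have rl (r : R) : exists q : rat, r - e / 2 < ratr q < r.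
  by have [|q] := @rat_in_itvoo R (r - e / 2) r; [lra|rewrite in_itv; exists q].
have [a /andP[a1 a2]] := rl (Re z); have [b /andP[b1 b2]] := rl (Im z).
exists (a, b) => /=; apply: (le_lt_trans (normc_ReIm _)); rewrite !raddfB/=.
by rewrite !ger0_norm ?subr_ge0 ?ltW//; lra.
Qed.

Lemma normc_prod (I : Type) (r : seq I) (F : I -> R[i]) :
  normc (\prod_(i <- r) F i) = \prod_(i <- r) normc (F i).
Proof.
elim: r => [|i r IH]; rewrite ?big_nil ?Normc.normc1//.
by rewrite !big_cons Normc.normcM IH.
Qed.

Lemma horner_prod_XsubC s z :
  (\prod_(w <- s) ('X - w%:P)).[z] = \prod_(w <- s) (z - w).
Proof. by rewrite horner_prod; apply: eq_bigr => w _; rewrite !hornerE. Qed.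

(** A point where a monic polynomial of degree m is less than e^m is at distance
    less than e from a root. *)
Lemma root_near s z (e : R) : 0 <= e ->
  normc (\prod_(w <- s) ('X - w%:P)).[z] < e ^+ size s ->
  exists2 w, w \in s & normc (z - w) < e.
Proof.
move=> e0; rewrite horner_prod_XsubC normc_prod.
elim: s => [|w s IH]; first by rewrite big_nil expr0 ltxx.
rewrite big_cons /= exprS => H.
have [zw|zw] := ltP (normc (z - w)) e; first by exists w => //; rewrite mem_head.
have [|w' w's zw'] := IH; last by exists w' => //; rewrite inE w's orbT.
rewrite ltNge; apply/negP => H'; move: H; apply/negP; rewrite -leNgt.
by rewrite ler_pM// exprn_ge0.
Qed.

Lemma horner_near_root s z (e : R) : z \in s -> 0 < e ->
  exists2 d : R, 0 < d & forall w, normc (z - w) < d ->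
    normc (\prod_(u <- s) ('X - u%:P)).[w] < e.
Proof.
move=> zs e0; have /perm_to_rem zs' := zs.
set t := rem z s in zs'.
pose C := \prod_(u <- t) (1 + normc (z - u)).
have C0 : 0 < C by apply: prodr_gt0 => u _; rewrite ltr_wpDr// normc_ge0.
(* near z the other factors are bounded by C, as |w - z| < 1 *)
exists (Num.min 1 (e / C)) => [|w]; first by rewrite lt_min ltr01 divr_gt0.
rewrite lt_min => /andP[zw1 zwe].
rewrite horner_prod_XsubC normc_prod (perm_big _ zs') big_cons /= normcB.
rewrite (@le_lt_trans _ _ (normc (z - w) * C))//; last by rewrite -ltr_pdivlMr.
rewrite ler_wpM2l ?normc_ge0//; apply: ler_prod => u _; rewrite normc_ge0/=.
rewrite (_ : w - u = (w - z) + (z - u)); last by ring.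
by rewrite (le_trans (le_normcD _ _))// lerD2r ltW// normcB.
Qed.

Lemma seq_neg_bound s (h : R[i] -> R) : (forall z, z \in s -> h z < 0) ->
  exists2 d : R, 0 < d & forall z, z \in s -> h z <= - d.
Proof.
elim: s => [|z s IH] H; first by exists 1.
have [|d d0 Hd] := IH; first by move=> w ws; apply: H; rewrite inE ws orbT.
have hz : h z < 0 by apply: H; rewrite mem_head.
exists (Num.min d (- h z)) => [|w]; first by rewrite lt_min d0 oppr_gt0.
rewrite inE => /orP[/eqP ->|ws]; first by rewrite lerNr ge_min lexx orbT.
by rewrite (le_trans (Hd _ ws))// lerN2 ge_min lexx.
Qed.

Lemma seq_max s (h : R[i] -> R) z0 : z0 \in s ->
  exists2 z, z \in s & forall w, w \in s -> h w <= h z.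
Proof.
elim: s z0 => [//|z s IH] z0 _; case: s IH => [_|u s /(_ u (mem_head _ _))].
  by exists z; rewrite ?mem_head// => w; rewrite inE => /eqP ->.
move=> [v vs Hv]; have [zv|vz] := leP (h z) (h v).
  exists v; first by rewrite inE vs orbT.
  by move=> w; rewrite inE => /orP[/eqP ->//|]; exact: Hv.
exists z; first exact: mem_head.
by move=> w; rewrite inE => /orP[/eqP ->//|/Hv/le_trans]; apply; exact: ltW.
Qed.

Lemma zerosE p : p != 0 -> p = lead_coef p *: \prod_(z <- zeros p) ('X - z%:P).
Proof. by rewrite /zeros => /negbTE ->; case: closed_field_poly_normal. Qed.

Lemma monic_zerosE p : p \is monic -> p = \prod_(z <- zeros p) ('X - z%:P).
Proof.
by move=> mp; rewrite {1}(zerosE (monic_neq0 mp)) (monicP mp) scale1r.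
Qed.

Lemma size_zeros p : p \is monic -> size p = (size (zeros p)).+1.
Proof. by move=> mp; rewrite {1}(monic_zerosE mp) size_prod_XsubC. Qed.

Lemma mem_zeros p z : p \is monic -> root p z = (z \in zeros p).
Proof. by move=> mp; rewrite {1}(monic_zerosE mp) root_prod_XsubC. Qed.

End roots.

Section measurable_roots.
Variables (R : realType) (d : measure_display) (T : measurableType d).
Implicit Types (p : T -> {poly R[i]}) (f : T -> R[i]).

(** The polynomial-valued functions all of whose coefficients are measurable. *)
Definition coef_measurable p :=
  forall i, measurable_fun setT (fun x => (p x)`_i).

Lemma measurable_horner p f n : coef_measurable p ->
  (forall x, (size (p x) <= n)%N) ->
  measurable_fun setT f -> measurable_fun setT (fun x => (p x).[f x]).
Proof.
move=> mp sp mf; under eq_fun do rewrite (horner_coef_wide _ (sp _)).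
apply: (@measurable_csum _ _ _ _ _ (fun (i : 'I_n) x => (p x)`_i * f x ^+ i)) => i.
by apply: measurable_cmulM => //; exact: measurable_cexp.
Qed.

(** Having a root in the closed set where h is nonnegative, a set that may
    itself vary measurably with x, is a countable condition: for every k there
    is a rational point where h is greater than -1/(k+1) and the polynomial is
    less than (k+1)^-m. *)
Lemma measurable_exists_root p m (h : T -> R[i] -> R) :
  coef_measurable p -> (forall x, p x \is monic) ->
  (forall x, size (p x) = m.+1) ->
  (forall q, measurable_fun setT (h^~ q)) ->
  (forall x z w, `|h x z - h x w| <= normc (z - w)) ->
  measurable [set x | exists2 z, root (p x) z & 0 <= h x z].
Proof.
move=> mp monp sp mh hL.
pose pt (q : rat * rat) : R[i] := ratr q.1 +i* ratr q.2.
pose e (k : nat) : R := k.+1%:R^-1.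
have e0 k : 0 < e k by rewrite invr_gt0 ltr0n.
have sr x : size (zeros (p x)) = m.
  by apply/eqP; rewrite -eqSS -size_zeros// sp.
rewrite (_ : [set x | _] = \bigcap_k \bigcup_q
  ([set x | - e k < h x (pt q)] `&` [set x | normc (p x).[pt q] < e k ^+ m])).
  apply: bigcapT_measurable => k; apply: countable_bigcupT_measurable => // q.
  apply: measurableI.
    rewrite (_ : [set x | _] =
      setT `&` (fun x => - e k < h x (pt q)) @^-1` [set true]).
      suff : measurable_fun setT (fun x => - e k < h x (pt q)) by apply.
      by apply: measurable_fun_ltr.
    by rewrite setTI; apply/seteqP; split.
  rewrite (_ : [set x | _] =
    setT `&` (fun x => normc (p x).[pt q] < e k ^+ m) @^-1` [set true]).
    suff : measurable_fun setT (fun x => normc (p x).[pt q] < e k ^+ m) by apply.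
    apply: measurable_fun_ltr => //; apply: measurable_normc.
    by apply: (@measurable_horner p (fun=> pt q) m.+1) => // x; rewrite sp.
  by rewrite setTI; apply/seteqP; split.
apply/seteqP; split=> [x /= [z rz hz] k _|x Hx /=].
  have zs : z \in zeros (p x) by rewrite -mem_zeros.
  have ek : 0 < e k ^+ m by rewrite exprn_gt0.
  have [dl d0 Hd] := horner_near_root zs ek.
  have [|q Hq] := @rational_point_near R z (Num.min dl (e k)).
    by rewrite lt_min d0 e0.
  move: Hq; rewrite lt_min => /andP[q1 q2].
  exists q => //; split=> /=; last by rewrite (monic_zerosE (monp x)); exact: Hd.
  have := le_lt_trans (hL x z (pt q)) q2; rewrite ltr_norml => /andP[? ?]; lra.
(* otherwise h is at most - dl on the finitely many roots, while some root is
   at distance less than e k from a point q where h is more than - e k *)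
apply: contrapT => no.
have [|dl d0 Hd] := @seq_neg_bound R (zeros (p x)) (h x).
  move=> z; rewrite -mem_zeros// => rz; rewrite ltNge; apply/negP => hz.
  by apply: no; exists z.
pose k := Num.truncn (2 / dl).
have ek : 2 * e k < dl.
  by rewrite /e ltr_pdivrMr ?ltr0n// mulrC -ltr_pdivrMr// truncnS_gt.
have [q _ [/= q1 q2]] := Hx k I.
have [|z zs zq] := @root_near R (zeros (p x)) (pt q) (e k) (ltW (e0 k)).
  by rewrite -monic_zerosE// sr.
have := Hd z zs; have := le_lt_trans (hL x (pt q) z) zq.
by rewrite ltr_norml => /andP[? ?] ?; lra.
Qed.

Lemma measurable_root p m : coef_measurable p -> (forall x, p x \is monic) ->
  (forall x, size (p x) = m.+2) ->
  exists2 r : T -> R[i], measurable_fun setT r & forall x, root (p x) (r x).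
Proof.
move=> mp monp sp.
(* the root of largest real part and, among those, of largest imaginary part *)
have ex x : exists z, root (p x) z /\ forall w, root (p x) w ->
    Re w <= Re z /\ (Re z <= Re w -> Im w <= Im z).
  have : size (zeros (p x)) = m.+1.
    by apply/eqP; rewrite -eqSS -size_zeros// sp.
  case E : (zeros (p x)) => [//|z0 s] _.
  have z0s : z0 \in zeros (p x) by rewrite E mem_head.
  have [z1 z1s Hz1] := seq_max (@complex.Re R) z0s.
  have z1s' : z1 \in [seq w <- zeros (p x) | Re w == Re z1].
    by rewrite mem_filter eqxx.
  have [z2] := seq_max (@complex.Im R) z1s'.
  rewrite mem_filter => /andP[/eqP z21 z2s] Hz2.
  exists z2; rewrite mem_zeros//; split=> // w; rewrite mem_zeros// => ws.
  rewrite z21; split; first exact: Hz1.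
  by move=> zw; apply: Hz2; rewrite mem_filter ws andbT eq_le zw Hz1.
have [r Hr] := choice ex.
have mRe : measurable_fun setT (fun x => Re (r x)).
  apply: (measurability _ (RGenCInfty.measurableE R)) => //.
  move=> _ [_ [t ->] <-]; rewrite setTI.
  rewrite (_ : _ @^-1` _ = [set x | exists2 z, root (p x) z & 0 <= Re z - t]).
    apply: (@measurable_exists_root p m.+1 (fun _ z => Re z - t)) => //.
    by move=> _ z w; rewrite opprB addrA subrK -raddfB Re_le_normc.
  apply/seteqP; split=> x /=; rewrite in_itv/= andbT.
    by move=> tr; exists (r x); [exact: (Hr x).1|rewrite subr_ge0].
  move=> [z /((Hr x).2 z)[zr _]]; rewrite subr_ge0 => /le_trans; exact.
exists r; last by move=> x; exact: (Hr x).1.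
apply: measurable_ReImP => //.
apply: (measurability _ (RGenCInfty.measurableE R)) => //.
move=> _ [_ [t ->] <-]; rewrite setTI.
rewrite (_ : _ @^-1` _ = [set x | exists2 z, root (p x) z &
    0 <= Num.min (Re z - Re (r x)) (Im z - t)]).
  apply: (@measurable_exists_root p m.+1
    (fun x z => Num.min (Re z - Re (r x)) (Im z - t))) => //.
    move=> q; apply: measurable_minr => //; apply: measurable_funB => //.
  move=> x z w.
  have := Re_le_normc (z - w); have := Im_le_normc (z - w).
  rewrite !raddfB/= !ler_norml => /andP[? ?] /andP[? ?]; apply/andP; split;
  by rewrite /Num.min; case: ifPn => ?; case: ifPn => ?; lra.
apply/seteqP; split=> x /=; rewrite in_itv/= andbT.
  move=> tr; exists (r x); first exact: (Hr x).1.
  by rewrite le_min subrr lexx subr_ge0.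
move=> [z /((Hr x).2 z)[_ zr]]; rewrite le_min !subr_ge0 => /andP[/zr ? ?].
exact: le_trans (_ : t <= Im z) _.
Qed.

(** The roots listed measurably; r i is irrelevant for i >= m. *)
Lemma measurable_roots m p : coef_measurable p -> (forall x, p x \is monic) ->
  (forall x, size (p x) = m.+1) ->
  exists2 r : nat -> T -> R[i], forall i, measurable_fun setT (r i) &
    forall x, p x = \prod_(i < m) ('X - (r i x)%:P).
Proof.
elim: m p => [|m IH] p mp monp sp.
  exists (fun _ _ => 0) => [i|x]; first exact: measurable_cst.
  rewrite big_ord0; have [c c0 E] := size_poly1P _ (introT eqP (sp x)).
  by have /monicP := monp x; rewrite E lead_coefC => ->.
have [r0 mr0 rr0] := measurable_root mp monp sp.
pose q x := p x %/ ('X - (r0 x)%:P).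
have pq x : p x = q x * ('X - (r0 x)%:P).
  by rewrite divpK // dvdp_XsubCl.
have sq x : size (q x) = m.+1.
  by rewrite /q size_divp ?polyXsubC_eq0// size_XsubC sp subn1.
have mq x : q x \is monic.
  by have := monp x; rewrite pq monicMr// monicXsubC.
(* the coefficients of the quotient come from the top one by p_(i+1) =
   q_i - r0 q_(i+1) *)
have cq : coef_measurable q.
  suff H j : forall i, (m.+1 <= i + j)%N -> measurable_fun setT (fun x => (q x)`_i).
    by move=> i; apply: (H m.+1); rewrite leq_addl.
  elim: j => [|j IHj] i ij.
    rewrite (_ : (fun x => _) = cst 0); first exact: measurable_cst.
    by apply/funext => x /=; rewrite nth_default// sq -(addn0 i).
  have E x : (q x)`_i = (p x)`_i.+1 + r0 x * (q x)`_i.+1.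
    by rewrite pq mulrBr coefB coefMX coefMC /= mulrC subrK.
  rewrite (funext E).
  apply: (@measurable_caddD _ _ _ (fun x => (p x)`_i.+1)); first exact: mp.
  apply: (@measurable_cmulM _ _ _ r0) => //; apply: IHj.
  by rewrite addSnnS.
have [r mr Er] := IH q cq mq sq.
exists (fun i => if i is j.+1 then r j else r0) => [[//|i]|x]; first exact: mr.
by rewrite big_ord_recl /= pq Er mulrC.
Qed.

Lemma measurable_size_poly p m : coef_measurable p ->
  measurable_fun setT (fun x => size (p x) == m.+1).
Proof.
move=> mp; apply: (measurable_fun_bool true) => //; rewrite setTI.
have c0 i : measurable [set x | (p x)`_i = 0].
  have := mp i measurableT _ (measurable_complex_set1 0); rewrite setTI; exact.
rewrite (_ : _ @^-1` _ = ~` [set x | (p x)`_m = 0] `&`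
    \bigcap_(i in [set i | m < i]%N) [set x | (p x)`_i = 0]).
  apply: measurableI; first exact: measurableC.
  by apply: bigcap_measurable => //; exists m.+1 => /=.
apply/seteqP; split=> x /=.
  move=> /eqP sp; split.
    apply/eqP; have : lead_coef (p x) != 0 by rewrite lead_coef_eq0 -size_poly_eq0 sp.
    by rewrite lead_coefE sp.
  by move=> i /= mi; rewrite nth_default// sp.
move=> [/eqP pm H]; apply/eqP/eqP; rewrite eqn_leq; apply/andP; split.
  by apply/leq_sizeP => i mi; exact: H.
by rewrite ltnNge; apply/negP => /leq_sizeP/(_ m (leqnn _))/eqP; rewrite (negbTE pm).
Qed.

End measurable_roots.

Section zeros.
Variable R : realType.
Implicit Types (s t : seq R[i]) (P : {poly R[i]}) (B : set R[i]).

Lemma perm_eq_zeros P c s : c != 0 ->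
  P = c *: \prod_(z <- s) ('X - z%:P) -> perm_eq (zeros P) s.
Proof.
move=> c0 E.
have P0 : P != 0 by rewrite E scaler_eq0 negb_or c0 monic_neq0// monic_prod_XsubC.
rewrite /zeros (negbTE P0); case: closed_field_poly_normal => t /= Et.
apply: prod_XsubC_eq; have lc : lead_coef P = c.
  by rewrite E lead_coefZ lead_coef_prod_XsubC mulr1.
by apply: (scalerI c0); rewrite -{1}lc -Et -E.
Qed.

Lemma zeros0 : zeros (0 : {poly R[i]}) = [::].
Proof. by rewrite /zeros eqxx. Qed.

Lemma eq_configuration (xi eta : configuration R) : mult xi = mult eta -> xi = eta.
Proof.
case: xi eta => f Hf [g Hg] /= fg; subst g.
by congr Configuration; exact: Prop_irrelevance.
Qed.

Lemma config_of_seq_perm s t : perm_eq s t -> config_of_seq s = config_of_seq t.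
Proof.
by move=> /permP st; apply: eq_configuration; apply/funext => z; exact: st.
Qed.

Lemma num_points_seq B s :
  num_points B (config_of_seq s) = (\sum_(z <- s) (\1_B z : R)%:E)%E.
Proof.
rewrite /num_points /=; elim: s => [|z s IH].
  by rewrite big_nil esum1.
rewrite big_cons -IH.
under eq_esum do rewrite /= natrD EFinD.
rewrite esumD//; [|by move=> *; rewrite lee_fin..]; congr (_ + _)%E.
rewrite esum_mkcond.
rewrite (_ : (fun i => _) = (fun i => if i \in [set z] then (\1_B i : R)%:E else 0%E)).
  by rewrite -esum_mkcondr setTI esum_set1// lee_fin.
apply/funext => w; rewrite indicE.
have -> : (w \in [set z]) = (z == w) by apply/idP/eqP; rewrite inE => ->.
by case: (z == w); case: (w \in B).
Qed.

Lemma num_points_map B (f : R[i] -> R[i]) s :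
  num_points B (config_of_seq (map f s)) = num_points (f @^-1` B) (config_of_seq s).
Proof.
by rewrite !num_points_seq big_map; apply: eq_bigr => z _; rewrite !indicE.
Qed.

End zeros.

Section measurable_zeros.
Variables (R : realType) (d : measure_display) (T : measurableType d).

Lemma measurable_configuration (f : T -> configuration R) :
  (forall B, measurable B -> measurable_fun setT (fun x => num_points B (f x))) ->
  measurable_fun setT f.
Proof.
move=> H; apply: (@measurability _ _ T _ setT f (@counting_sets R)) => //.
move=> _ [_ [B mB [Y mY ->]] <-].
exact: (H B mB measurableT Y mY).
Qed.

Lemma measurable_num_points (f : T -> configuration R) B : measurable B ->
  measurable_fun setT f -> measurable_fun setT (fun x => num_points B (f x)).
Proof.
move=> mB mf _ Y mY; have := mf measurableT (num_points B @^-1` Y); apply.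
by apply: sub_sigma_algebra; exists B => //; exists Y.
Qed.

(** The degree of p x may vary with x, and p x may vanish. *)
Lemma measurable_zeros (p : T -> {poly R[i]}) n : coef_measurable p ->
  (forall x, (size (p x) <= n)%N) ->
  measurable_fun setT (fun x => config_of_seq (zeros (p x))).
Proof.
move=> mp sp; apply: measurable_configuration => B mB.
(* for each m, normalize the polynomials of degree m, and let q m x be X^m
   elsewhere *)
pose q m x : {poly R[i]} :=
  if size (p x) == m.+1 then (lead_coef (p x))^-1 *: p x else 'X^m.
have mq m x : q m x \is monic.
  rewrite /q; case: eqP => [E|_]; last exact: monicXn.
  by rewrite monicE lead_coefZ mulVf// lead_coef_eq0 -size_poly_eq0 E.
have sq m x : size (q m x) = m.+1.
  rewrite /q; case: eqP => [E|_]; last by rewrite size_polyXn.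
  by rewrite size_scale// invr_eq0 lead_coef_eq0 -size_poly_eq0 E.
have cq m : coef_measurable (q m).
  move=> i; rewrite (_ : (fun x => _) = (fun x => if size (p x) == m.+1 then
    cinv ((p x)`_m) * (p x)`_i else ('X^m : {poly R[i]})`_i)).
    apply: measurable_fun_ifT; first exact: measurable_size_poly.
      apply: (@measurable_cmulM _ _ _ (fun x => cinv ((p x)`_m))) => //.
      by apply: measurableT_comp (mp m); exact: measurable_cinv.
    exact: measurable_cst.
  apply/funext => x; rewrite /q; case: eqP => // E.
  by rewrite coefZ lead_coefE E /cinv div1r.
have /choice[r Hr] : forall m, exists r : nat -> T -> R[i],
    (forall i, measurable_fun setT (r i)) /\
    forall x, q m x = \prod_(i < m) ('X - (r i x)%:P).
  by move=> m; have [r r1 r2] := measurable_roots (cq m) (mq m) (sq m); exists r.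
rewrite (_ : (fun x => _) = (fun x => \sum_(m < n) (if size (p x) == m.+1 then
   \sum_(i < m) (\1_B (r m i x) : R)%:E else 0)%E)%E).
  apply: emeasurable_sum => m; apply: measurable_fun_ifT => //.
    exact: measurable_size_poly.
  apply: emeasurable_sum => i; apply/measurable_EFinP.
  apply: measurableT_comp; first exact: measurable_indic.
  exact: (Hr m).1.
apply/funext => x; have [p0|p0] := eqVneq (p x) 0.
  rewrite p0 zeros0 num_points_seq big_nil big1// => m _.
  by rewrite size_poly0.
have sp0 : (0 < size (p x))%N by rewrite size_poly_gt0.
have sn : ((size (p x)).-1 < n)%N by rewrite prednK.
rewrite (bigD1 (Ordinal sn))//= prednK// eqxx [X in (_ + X)%E]big1 ?adde0; last first.
  by move=> m /eqP mn; case: ifP => // /eqP E; case: mn; apply/val_inj; rewrite /= E.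
have := (Hr (size (p x)).-1).2 x; rewrite /q prednK// eqxx => E.
have lc0 : lead_coef (p x) != 0 by rewrite lead_coef_eq0.
have perm := @perm_eq_zeros _ (p x) (lead_coef (p x))
  [seq r (size (p x)).-1 i x | i <- iota 0 (size (p x)).-1] lc0.
rewrite (config_of_seq_perm (perm _)) ?num_points_seq ?big_map.
  rewrite -(big_mkord xpredT (fun i =>
    (\1_B (r (size (p x)).-1 i x) : R)%:E)).
  by rewrite /index_iota subn0.
rewrite -[iota _ _](_ : index_iota 0 (size (p x)).-1 = _); last first.
  by rewrite /index_iota subn0.
by rewrite big_mkord -E scalerA mulfV// scale1r.
Qed.

End measurable_zeros.

(** * Laws, exchangeability, and zeros of transformed polynomials *)

Section laws.
Context d (Omega : measurableType d) (R : realType) (Pr : probability Omega R).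

Lemma probability_ae_eq (A B : set Omega) : measurable A -> measurable B ->
  {ae Pr, forall w, A w <-> B w} -> Pr A = Pr B.
Proof.
move=> mA mB AB; rewrite -[A]setIT -[B]setIT -!integral_indic//.
apply: ae_eq_integral => //.
- by apply/measurable_EFinP; exact: measurable_indic.
- by apply/measurable_EFinP; exact: measurable_indic.
apply: filterS AB => w [h1 h2] _; congr (_%:E); rewrite !indicE.
by congr (_%:R); congr nat_of_bool; apply/idP/idP; rewrite !inE.
Qed.

Lemma same_law_pi_system d' (T : measurableType d') (G : set (set T))
    (X Y : Omega -> T) :
  measurable = <<s G >> -> setI_closed G -> G setT ->
  measurable_fun setT X -> measurable_fun setT Y ->
  (forall A, G A -> Pr (X @^-1` A) = Pr (Y @^-1` A)) -> same_law Pr X Y.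
Proof.
move=> mG GI GT mX mY XY; split=> // E mE.
pose X' : {mfun Omega >-> T} := HB.pack X (isMeasurableFun.Build _ _ _ _ X mX).
pose Y' : {mfun Omega >-> T} := HB.pack Y (isMeasurableFun.Build _ _ _ _ Y mY).
apply: (@measure_unique _ R T G (fun=> setT) mG GI _ _
  (distribution Pr X') (distribution Pr Y') XY _ E mE) => //.
  by apply: bigcup_const; exists 0%N.
move=> k.
rewrite (le_lt_trans (probability_le1 (distribution Pr X') measurableT))//.
exact: ltry.
Qed.

(** The joint law of a finite i.i.d. family is invariant under permutations. It
    is enough to compare the masses of the rectangles, which are products of
    the masses of their sides. *)
Lemma iid_exchangeable d' (T : measurableType d') n (a : 'I_n -> Omega -> T)
    (s : 'I_n -> 'I_n) : iid Pr a -> injective s ->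
  same_law Pr (fun w => [tuple a i w | i < n])
    (fun w => [tuple a (s i) w | i < n]).
Proof.
move=> [ma inda lawa] s_inj.
pose rect (B : 'I_n -> set T) : set (n.-tuple T) := 
  \bigcap_i [set t | B i (tnth t i)].
have mtup (f : 'I_n -> 'I_n) :
    measurable_fun setT (fun w => [tuple a (f i) w | i < n]).
  apply/measurable_fun_tnthP => i.
  rewrite (_ : _ \o _ = a (f i)); first exact: ma.
  by apply/funext => w /=; rewrite tnth_mktuple.
apply: (same_law_pi_system
  (G := [set rect B | B in [set B | forall i, measurable (B i)]])).
- apply/seteqP; split.
    apply: smallest_sub; first exact: smallest_sigma_algebra.
    move=> F; rewrite -bigcup_seq => -[i _ [B mB <-]].
    apply: sub_sigma_algebra; exists (fun j => if j == i then B else setT).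
      by move=> j /=; case: ifP.
    rewrite setTI; apply/seteqP; split=> [t /(_ i I)|t Bt j _] /=.
      by rewrite /= eqxx.
    by case: eqP => [->|].
  apply: smallest_sub; first exact: sigma_algebra_measurable.
  move=> _ [B mB <-]; apply: fin_bigcap_measurable => // i _.
  by have := measurable_tnth i measurableT (mB i); rewrite setTI.
- move=> _ _ [A mA <-] [B mB <-]; exists (fun i => A i `&` B i).
    by move=> i; exact: measurableI.
  apply/seteqP; split=> [t H|t [HA HB] i _]; last by split; [exact: HA|exact: HB].
  by split=> i _; have [] := H i I.
- by exists (fun=> setT) => //; apply/seteqP; split=> // t _ i _.
- exact: (mtup id).
- exact: (mtup s).
move=> _ [B mB <-].
have E (f : 'I_n -> 'I_n) : injective f ->
    Pr ((fun w => [tuple a (f i) w | i < n]) @^-1` rect B) =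
    (\prod_i Pr (a i @^-1` B i))%E.
  move=> f_inj; pose g := invF f_inj; pose Bg i := B (g i).
  rewrite (_ : _ @^-1` _ = \bigcap_(i in [set` [set: 'I_n]%SET]) (a i @^-1` Bg i)).
    rewrite (inda [set: 'I_n]%SET Bg); last by move=> i; exact: mB.
    rewrite (reindex_inj f_inj); apply: eq_big => [i|i _]; first by rewrite inE.
    have [_ _ ->//] := lawa (f i) i; last exact: mB.
    by rewrite /Bg /g invF_f.
  apply/seteqP; split=> [w H i _|w H i _] /=.
    by have := H (g i) I; rewrite /= tnth_mktuple f_invF.
  by have := H (f i); rewrite /= inE /Bg /g invF_f tnth_mktuple; exact.
by rewrite (E id) ?(E s).
Qed.

End laws.

Section zeros_transforms.
Variable R : realType.
Implicit Types (s : seq R[i]) (P Q : {poly R[i]}).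

(** Zeros of the polynomial c P(X / l). *)
Lemma perm_eq_zeros_scale P Q (c l : R[i]) : c != 0 -> l != 0 ->
  (forall k, Q`_k = c * l^-1 ^+ k * P`_k) ->
  perm_eq (zeros Q) [seq l * z | z <- zeros P].
Proof.
move=> c0 l0 H.
have -> : Q = c *: (P \Po (l^-1 *: 'X)).
  apply/polyP => k; rewrite H coefZ -mulrA; congr (_ * _).
  have -> : P \Po (l^-1 *: 'X) = \poly_(i < size P) (P`_i * l^-1 ^+ i).
    rewrite comp_polyE poly_def; apply: eq_bigr => i _.
    by rewrite exprZn scalerA.
  rewrite coef_poly; case: ltnP => [_|k_ge]; first by rewrite mulrC.
  by rewrite nth_default ?mulr0.
have [->|P0] := eqVneq P 0.
  by rewrite comp_poly0 scaler0 zeros0.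
have E s : \prod_(z <- s) ('X - z%:P) \Po (l^-1 *: 'X) =
    (l^-1 ^+ size s) *: \prod_(z <- map (fun z => l * z) s) ('X - z%:P).
  elim: s => [|z s IH].
    by rewrite !big_nil /= expr0 scale1r -[1]/(1%:P) comp_polyC.
  rewrite !big_cons comp_polyM IH /= exprS comp_polyB comp_polyX comp_polyC.
  have -> : l^-1 *: 'X - z%:P = l^-1 *: ('X - (l * z)%:P).
    by rewrite scalerBr -!mul_polyC -polyCM mulKf.
  by rewrite -scalerAl -scalerAr scalerA.
apply: (perm_eq_zeros (c := c * lead_coef P * l^-1 ^+ size (zeros P))).
  by rewrite !mulf_neq0 ?lead_coef_eq0// expf_neq0 ?invr_eq0.
by rewrite {1}(zerosE P0) comp_polyZ E !scalerA.
Qed.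

(** The reciprocal polynomial of the product of the X - z is the product of the
    1 - zX. *)
Lemma reverse_prod_XsubC s k : (\prod_(z <- s) (1 - z *: 'X))`_k =
  if (k <= size s)%N then (\prod_(z <- s) ('X - z%:P))`_(size s - k) else 0.
Proof.
elim: s k => [|z s IH] k.
  by rewrite !big_nil /= coef1; case: k => [|k] //=; rewrite coef1.
rewrite !big_cons mulrBl mul1r coefB -scalerAl coefZ coefXM !IH /=.
rewrite mulrBl coefB coefXM coefCM.
have top j : (size s < j)%N -> (\prod_(w <- s) ('X - w%:P))`_j = 0.
  by move=> sj; rewrite nth_default// size_prod_XsubC.
case: k => [|k] /=.
  by rewrite !subn0 /= (top _ (ltnSn _)) !mulr0.
rewrite subSS ltnS subn_eq0.
case: (ltngtP k (size s)) => [ks|ks|->] //; first by rewrite subnS.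
by rewrite mulr0 subr0.
Qed.

Lemma prod_reverse_XsubC s : (forall z, z \in s -> z != 0) ->
  \prod_(z <- s) (1 - z *: 'X) =
  (\prod_(z <- s) - z) *: \prod_(z <- [seq 1 / z | z <- s]) ('X - z%:P).
Proof.
elim: s => [|z s IH] s0; first by rewrite !big_nil scale1r.
have z0 : z != 0 by apply: s0; rewrite mem_head.
rewrite /= !big_cons IH; last by move=> w ws; apply: s0; rewrite inE ws orbT.
have -> : 1 - z *: 'X = (- z) *: ('X - (1 / z)%:P).
  rewrite scalerBr scaleNr -[X in _ = _ - X]mul_polyC -polyCM.
  by rewrite mulNr div1r mulfV// polyCN opprK addrC.
by rewrite -scalerAl -scalerAr scalerA.
Qed.

(** Zeros of the polynomial c X^n P(1 / X). *)
Lemma perm_eq_zeros_reverse P Q n (c : R[i]) :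
  c != 0 -> size P = n.+1 -> P`_0 != 0 ->
  (forall k, Q`_k = if (k <= n)%N then c * P`_(n - k) else 0) ->
  perm_eq (zeros Q) [seq 1 / z | z <- zeros P].
Proof.
move=> c0 sP P00 H.
have P0 : P != 0 by rewrite -size_poly_eq0 sP.
have lP0 : lead_coef P != 0 by rewrite lead_coef_eq0.
have PE := zerosE P0.
have sz : size (zeros P) = n.
  by apply/eqP; rewrite -eqSS -sP {2}PE size_scale// size_prod_XsubC.
have zn0 z : z \in zeros P -> z != 0.
  move=> zP; apply: contraNneq P00 => z0; rewrite -horner_coef0 -/(root P 0).
  by rewrite PE rootZ// root_prod_XsubC -z0.
apply: (perm_eq_zeros (c := c * lead_coef P * \prod_(z <- zeros P) - z)).
  rewrite !mulf_neq0// prodf_seq_neq0; apply/allP => z /zn0 z0 /=.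
  by rewrite oppr_eq0.
rewrite -scalerA -prod_reverse_XsubC//; apply/polyP => k.
rewrite H coefZ reverse_prod_XsubC sz; case: ifP => _; last by rewrite mulr0.
by rewrite {1}PE coefZ mulrA.
Qed.

End zeros_transforms.

(** * Zeros of the random polynomials *)

Section zero_processes.
Variable R : realType.

Lemma coef_random_poly (mu : complex_probability R) n (a : 'I_n.+1 -> R[i]) k :
  (random_poly mu a)`_k =
  if (k <= n)%N then a (inord k) * basis_coef mu n k else 0.
Proof. by rewrite random_polyE coef_poly ltnS. Qed.

Lemma measurable_random_zeros (mu : complex_probability R) d
    (T : measurableType d) n (a : 'I_n.+1 -> T -> R[i]) : (forall i, measurable_fun setT (a i)) ->
  measurable_fun setT (fun x => config_of_seq (zeros (random_poly mu (a^~ x)))).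
Proof.
move=> ma; apply: (@measurable_zeros _ _ _ _ n.+1); last first.
  by move=> x; rewrite random_polyE; exact: size_poly.
move=> k; under eq_fun do rewrite coef_random_poly.
case: (k <= n)%N; last exact: measurable_cst.
apply: (@measurable_cmulM _ _ _ (a (inord k))) => //; exact: measurable_cst.
Qed.

Variable nu : complex_probability R.
Hypotheses (nu_rot : rotation_invariant nu) (nu_log : log_integrable nu).

Lemma zeros_dilation n (a : 'I_n.+1 -> R[i]) (lambda : R) : 0 < lambda ->
  config_of_seq [seq lambda%:C * z | z <- zeros (random_poly nu a)] =
  config_of_seq (zeros (random_poly (dilation nu lambda) a)).
Proof.
move=> l0; have lC0 : lambda%:C != 0 :> R[i] by rewrite fmorph_eq0 gt_eqF.
apply/esym/config_of_seq_perm.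
apply: (perm_eq_zeros_scale (c := lambda%:C ^+ n)) => //; first exact: expf_neq0.
move=> k; rewrite !coef_random_poly; case: ifP => _; last by rewrite mulr0.
rewrite basis_coef_dilation// rmorphM rmorphXn fmorphV rmorphXn exprVn.
by ring.
Qed.

Lemma zeros_inversion n (a : 'I_n.+1 -> R[i]) : (0 < n)%N ->
  a ord0 != 0 -> a ord_max != 0 ->
  config_of_seq [seq 1 / z | z <- zeros (random_poly nu a)] =
  config_of_seq (zeros (random_poly (inversion nu) (fun k => a (rev_ord k)))).
Proof.
move=> n0 a0 an; apply/esym/config_of_seq_perm.
have b0 : basis_coef nu n 0 != 0.
  by apply: basis_coef_neq0; [exact: moment_gt0|exact: moment0_lty].
have bn : basis_coef nu n n != 0.
  by apply: basis_coef_neq0; [exact: moment_gt0|exact: moment_top_lty].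
pose c : R[i] := ((expR (n%:R * fine (log_potential nu 0)))^-1)%:C.
have c0 : c != 0 by rewrite fmorph_eq0 invr_eq0 gt_eqF// expR_gt0.
apply: (perm_eq_zeros_reverse (n := n) (c := c)) => //.
- apply/eqP; rewrite eqn_leq random_polyE size_poly/= -random_polyE.
  rewrite ltnNge; apply/negP => /leq_sizeP/(_ n (leqnn _))/eqP.
  rewrite coef_random_poly leqnn mulf_eq0 (negbTE bn) orbF.
  rewrite (_ : inord n = ord_max) ?(negbTE an)//.
  by apply/val_inj; rewrite /= inordK.
- rewrite coef_random_poly leq0n mulf_neq0//.
  by rewrite (_ : inord 0 = ord0)//; apply/val_inj; rewrite /= inordK.
- move=> k; rewrite !coef_random_poly leq_subr; case: ifP => // kn.
  rewrite basis_coef_inversion// -/c (_ : rev_ord (inord k) = inord (n - k)).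
    by rewrite mulrCA.
  by apply/val_inj; rewrite /= !inordK ?ltnS ?leq_subr// subSS.
Qed.

End zero_processes.

Theorem theorem1p14 (R : realType) (nu : probability R[i] R)
    (nu_rot : rotation_invariant nu) (nu_log : log_integrable nu)
    (n : nat) (n_ge1 : (1 <= n)%N)
    (d : measure_display) (Omega : measurableType d) (Pr : probability Omega R)
    (a : 'I_n.+1 -> Omega -> R[i]) (a_iid : iid Pr a)
    (a_neq0 : Pr [set w | a ord0 w != 0] = 1%E) :
  (forall lambda : R, 0 < lambda ->
     same_law Pr
       (fun w => config_of_seq
          [seq lambda%:C * z | z <- zeros (random_poly nu (a^~ w))])
       (fun w => config_of_seq
          (zeros (random_poly (dilation nu lambda) (a^~ w))))) /\
  same_law Pr
    (fun w => config_of_seq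
       [seq 1 / z | z <- zeros (random_poly nu (a^~ w))])
    (fun w => config_of_seq
       (zeros (random_poly (inversion nu) (a^~ w)))).
Proof.
have [ma _ lawa] := a_iid.
split=> [lambda l0|].
  have E : (fun w => config_of_seq
      [seq lambda%:C * z | z <- zeros (random_poly nu (a^~ w))]) =
    (fun w => config_of_seq (zeros (random_poly (dilation nu lambda) (a^~ w)))).
    by apply/funext => w; exact: zeros_dilation.
  by rewrite E; split=> //; exact: measurable_random_zeros.
pose X w := config_of_seq [seq 1 / z | z <- zeros (random_poly nu (a^~ w))].
(* the zeros for the inverted measure, as a function of the coefficients *)
pose Phi (t : n.+1.-tuple R[i]) :=
  config_of_seq (zeros (random_poly (inversion nu) (tnth t))).
have mPhi : measurable_fun setT Phi.
  apply: (measurable_random_zeros _ (a := fun i t => tnth t i)) => i.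
  exact: measurable_tnth.
have mX : measurable_fun setT X.
  apply: measurable_configuration => B mB.
  under eq_fun do rewrite num_points_map.
  apply: measurable_num_points; last exact: measurable_random_zeros.
  by have := @measurable_cinv R measurableT B mB; rewrite setTI.
have [mt mt' lawt] := iid_exchangeable a_iid (@rev_ord_inj n.+1).
have tE (s : 'I_n.+1 -> 'I_n.+1) w :
    tnth [tuple a (s i) w | i < n.+1] = (fun i => a (s i) w).
  by apply/funext => i; rewrite tnth_mktuple.
split=> //; first exact: measurable_random_zeros.
move=> E mE.
(* the coefficients are almost surely nonzero *)
have ae0 i : {ae Pr, forall w, a i w != 0}.
  exists (a i @^-1` [set 0]); split.
  - by rewrite -[X in measurable X]setTI; apply: ma => //; exact: measurable_complex_set1.
  - have [_ _ ->//] := lawa i ord0; last exact: measurable_complex_set1.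
    have m0 : measurable (a ord0 @^-1` [set 0]).
      by rewrite -[X in measurable X]setTI; apply: ma => //; exact: measurable_complex_set1.
    rewrite -[X in Pr X]setCK probability_setC; last exact: measurableC.
    rewrite (_ : ~` _ = [set w | a ord0 w != 0]) ?a_neq0 ?subee//.
    by apply/seteqP; split=> w /= /eqP.
  - by move=> w /= /negP; rewrite negbK => /eqP.
have mPE : measurable (Phi @^-1` E) by rewrite -[X in measurable X]setTI; exact: mPhi.
transitivity (Pr
  ((fun w => [tuple a (rev_ord i) w | i < n.+1]) @^-1` (Phi @^-1` E))).
  apply: probability_ae_eq.
  - by rewrite -[X in measurable X]setTI; exact: mX.
  - by rewrite -[X in measurable X]setTI; exact: mt'.
  apply: filterS2 (ae0 ord0) (ae0 ord_max) => w a0 an.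
  by rewrite /= /X /Phi (tE (@rev_ord n.+1)) zeros_inversion.
(* Phi evaluated at the coefficients in their original order is the second
   point process *)
rewrite -lawt//; congr (Pr _); apply/seteqP; split=> w /=;
  by rewrite /Phi (tE id).
Qed.
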